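(* Let $\mathcal H$ be a Hilbert space. For any $P_0\in\mathcal P_\infty(\mathcal H)$, the set $$\mathcal C(P_0)=\{Q\in\mathcal P(\mathcal H): P_0Q\text{ is compact}\}$$ is a smooth manifold modelled in $\mathcal A_{P_0}(\mathcal H)_h$.
   Context: $\mathcal P(\mathcal H)$ is the set of orthogonal projections of $\mathcal H$ and $\mathcal P_\infty(\mathcal H)$ the set of those with infinite-dimensional range and infinite-dimensional nullspace. $\mathcal A_{P_0}(\mathcal H)$ is the C$^*$-algebra of bounded linear operators $T$ on $\mathcal H$ such that $TP_0-P_0T$ is compact, and $\mathcal A_{P_0}(\mathcal H)_h$ is the space of its selfadjoint elements. *)

(* Defs.v *)
From HB Require Import structures.
From mathcomp Require Import all_boot all_order all_algebra.
From mathcomp Require Import complex.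
From mathcomp Require Import all_classical all_reals all_analysis.

Set Implicit Arguments.
Unset Strict Implicit.
Unset Printing Implicit Defensive.

Import Order.TTheory GRing.Theory Num.Theory Num.Def.
Import numFieldNormedType.Exports.

Local Open Scope classical_set_scope.
Local Open Scope ring_scope.

Section OperatorBound.
Context {R : realType} {V W : Type} (nV : V -> R) (nW : W -> R).

Definition op_bounds (f : V -> W) : set R :=
  [set M | 0 <= M /\ forall x, nW (f x) <= M * nV x].

(* Equals the usual operator norm sup {nW (f x) | nV x <= 1} when f is linear
   and bounded. *)
Definition op_norm (f : V -> W) : R := inf (op_bounds f).

Lemma op_norm_le f M : op_bounds f M -> op_norm f <= M.
Proof. by move=> fM; apply: ge_inf => //; exists 0 => y []. Qed.

Lemma op_norm_ge0 f : 0 <= op_norm f.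
Proof.
rewrite /op_norm; have [->|/set0P f0] := eqVneq (op_bounds f) set0.
  by rewrite inf0.
by apply: lb_le_inf => // y [].
Qed.

Hypothesis nV0 : forall x, 0 <= nV x.

Lemma op_normP f : op_bounds f !=set0 -> op_bounds f (op_norm f).
Proof.
move=> f0; split; first exact: op_norm_ge0.
move=> x; have [nx0|nx0] := eqVneq (nV x) 0.
  by case: f0 => M [_ /(_ x)]; rewrite nx0 !mulr0.
have nx : 0 < nV x by rewrite lt_neqAle eq_sym nx0 nV0.
rewrite -ler_pdivrMr//; apply: lb_le_inf => // M [_ fM].
by rewrite ler_pdivrMr.
Qed.

End OperatorBound.

Section BoundedLinear.
Context {K : numFieldType} (V W : normedModType K).

Definition blinear_pred : {pred V -> W} :=
  fun f => `[< linear f /\ continuous f >].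

Lemma blinear_submod : submod_closed blinear_pred.
Proof.
split.
  apply/asboolP; split; first by move=> a x y /=; rewrite scaler0 addr0.
  exact: cst_continuous.
move=> a f g /asboolP[lf cf] /asboolP[lg cg]; apply/asboolP; split.
  move=> b x y; rewrite !fctE lf lg !scalerDr !scalerA [a * b]mulrC -!addrA.
  by congr (_ + _); rewrite addrCA.
move=> x; apply: (@continuousD _ _ _ (fun x => a *: f x) g); last exact: cg.
by apply: continuousZr; exact: cf.
Qed.

HB.instance Definition _ :=
  GRing.isSubmodClosed.Build K (V -> W) blinear_pred blinear_submod.

(* The bounded operators V -> W; for linear maps, continuous = bounded. *)
Record blinear := BLinear {
  blinear_fun :> V -> W;
  blinearP : blinear_fun \in blinear_pred }.

HB.instance Definition _ := [isSub for blinear_fun].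
HB.instance Definition _ := [Choice of blinear by <:].
HB.instance Definition _ := [SubChoice_isSubLmodule of blinear by <:].

End BoundedLinear.

Lemma blinear_linear {K : numFieldType} {V W : normedModType K}
  (f : blinear V W) : linear f.
Proof. by have /asboolP[] := blinearP f. Qed.

Lemma blinear_continuous {K : numFieldType} {V W : normedModType K}
  (f : blinear V W) : continuous f.
Proof. by have /asboolP[] := blinearP f. Qed.

HB.instance Definition _ {K : numFieldType} {V W : normedModType K}
  (f : blinear V W) := GRing.isLinear.Build K V W *:%R f (blinear_linear f).

Lemma blinear_bound {K : numFieldType} {V W : normedModType K}
  (f : blinear V W) : exists M : K, 0 <= M /\ forall x, `|f x| <= M * `|x|.
Proof.
have /linear_bounded_continuous/linear_boundedP := @blinear_continuous _ _ _ f.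
move=> /pinfty_ex_gt0[M M0 fM]; exists M; split; [exact: ltW|exact: fM].
Qed.

Lemma blinearDE {K : numFieldType} {V W : normedModType K}
  (f g : blinear V W) x : (f + g) x = f x + g x.
Proof. by []. Qed.

Lemma blinearZE {K : numFieldType} {V W : normedModType K}
  (a : K) (f : blinear V W) x : (a *: f) x = a *: f x.
Proof. by []. Qed.

Section BLinearNorm.
Context {R : realType} (V W : normedModType R).

Let nV (x : V) : R := `|x|.
Let nW (x : W) : R := `|x|.
Let nrm (f : blinear V W) := op_norm nV nW f.

Let nrmP (f : blinear V W) : op_bounds nV nW f (nrm f).
Proof.
apply: op_normP; first by move=> x; exact: normr_ge0.
by have [M ?] := blinear_bound f; exists M.
Qed.

Let nrmD f g : nrm (f + g) <= nrm f + nrm g.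
Proof.
have [[f0 fM] [g0 gM]] := (nrmP f, nrmP g).
apply: op_norm_le; split; first exact: addr_ge0.
move=> x; rewrite mulrDl.
exact: le_trans (ler_normD _ _) (lerD (fM x) (gM x)).
Qed.

Let nrmZ_le l f : nrm (l *: f) <= `|l| * nrm f.
Proof.
have [f0 fM] := nrmP f.
apply: op_norm_le; split; first exact: mulr_ge0.
by move=> x; rewrite /nW blinearZE normrZ -mulrA ler_wpM2l.
Qed.

Let nrm0 f : nrm f = 0 -> f = 0.
Proof.
move=> f0; have [_] := nrmP f; rewrite f0 => fM.
apply/val_inj/funext => x /=; apply/eqP.
by rewrite -normr_le0; have := fM x; rewrite mul0r.
Qed.

Let nrmZ l f : nrm (l *: f) = `|l| * nrm f.
Proof.
apply/eqP; rewrite eq_le nrmZ_le /=; have [->|l0] := eqVneq l 0.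
  by rewrite normr0 mul0r op_norm_ge0.
rewrite -ler_pdivlMl ?normr_gt0// -normfV -{1}[f]scale1r -(mulVf l0) -scalerA.
exact: nrmZ_le.
Qed.

HB.instance Definition _ :=
  Lmodule_isNormed.Build R (blinear V W) nrmD nrmZ nrm0.

Lemma blinear_normE (f : blinear V W) :
  `|f| = op_norm (fun x : V => `|x|) (fun x : W => `|x|) f.
Proof. by []. Qed.

End BLinearNorm.

Section Smooth.
Context {R : realType}.

(* Textbook C^k in the sense of Frechet, for U open: the derivative x |-> 'd f x
   is a map from U to the space blinear E F with the operator norm.  The
   derivative of a differentiable map is continuous, so on U the default value 0
   of insubd is never used. *)
Fixpoint Ck (k : nat) (E F : normedModType R) (U : set E) (f : E -> F) : Prop :=
  match k with
  | 0 => forall x, U x -> {for x, continuous f}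
  | k'.+1 => (forall x, U x -> differentiable f x) /\
      Ck k' U (fun x => insubd (0 : blinear E F) ('d f x : E -> F))
  end.

Definition smooth (E F : normedModType R) (U : set E) (f : E -> F) :=
  forall k, Ck k U f.

(* A smooth chart of a subset S of E, with the topology of E: the smooth
   structure is the one that S inherits from E, so that the chart is the
   restriction to S of a smooth map on an open set of E and its inverse is
   smooth into E.  model_in and model_out identify the model space with a closed
   complemented subspace of E; in particular it is complete when E is.  The model
   space may depend on the chart and need not be E itself: in the space of
   projections, 0 is an isolated point. *)
Record chart (E : normedModType R) (S : set E) := Chart {
  model : normedModType R;
  model_in : blinear model E;
  model_out : blinear E model;
  model_split : cancel model_in model_out;
  chart_dom : set E;
  chart_img : set model;
  chart_map : E -> model;
  chart_inv : model -> E;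
  chart_dom_open : open chart_dom;
  chart_img_open : open chart_img;
  chart_map_img : forall x, (S `&` chart_dom) x -> chart_img (chart_map x);
  chart_inv_dom : forall u, chart_img u -> (S `&` chart_dom) (chart_inv u);
  chart_mapK : forall x, (S `&` chart_dom) x -> chart_inv (chart_map x) = x;
  chart_invK : forall u, chart_img u -> chart_map (chart_inv u) = u;
  chart_map_smooth : smooth chart_dom chart_map;
  chart_inv_smooth : smooth chart_img chart_inv }.

Arguments chart_dom {E S} c _ : rename.
Arguments chart_img {E S} c _ : rename.
Arguments chart_map {E S} c _ : rename.
Arguments chart_inv {E S} c _ : rename.

Definition smooth_manifold_in (E : normedModType R) (S : set E) : Prop :=
  exists atlas : chart S -> Prop,
    (forall x, S x -> exists2 c, atlas c & chart_dom c x) /\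
    (forall c d, atlas c -> atlas d ->
      smooth [set u | chart_img c u /\ chart_dom d (chart_inv c u)]
             (chart_map d \o chart_inv c)).

End Smooth.


Section CompactOperators.
Context {K : numFieldType} {V : normedModType K}.

Definition compact_op (T : V -> V) := precompact (T @` [set x | `|x| <= 1]).

Lemma compact_op0 : compact_op (0 : V -> V).
Proof.
apply: (@precompact_subset _ _ [set 0]); first by move=> _ [x _ <-].
rewrite precompact_closed; first exact: compact_set1.
by apply: compact_closed; [exact: norm_hausdorff|exact: compact_set1].
Qed.

Lemma compact_opD (S T : V -> V) :
  compact_op S -> compact_op T -> compact_op (S + T).
Proof.
rewrite /compact_op !precompactE => cS cT.
rewrite -precompactE; apply: (@precompact_subset _ _
  ((fun x : V * V => x.1 + x.2) @`
     (closure (S @` [set x | `|x| <= 1]) `*`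
      closure (T @` [set x | `|x| <= 1])))).
  move=> _ [x x1 <-]; exists (S x, T x) => //; split; apply: subset_closure;
    by exists x.
have C : compact ((fun x : V * V => x.1 + x.2) @`
     (closure (S @` [set x | `|x| <= 1]) `*`
      closure (T @` [set x | `|x| <= 1]))).
  apply: continuous_compact; last exact: compact_setX.
  by apply: continuous_subspaceT => x; exact: add_continuous.
rewrite precompact_closed//; apply: compact_closed C; exact: norm_hausdorff.
Qed.

Lemma compact_opZ (a : K) (T : V -> V) : compact_op T -> compact_op (a *: T).
Proof.
rewrite /compact_op precompactE => cT.
have C : compact ((fun x : V => a *: x) @` closure (T @` [set x | `|x| <= 1])).
  apply: continuous_compact cT.
  by apply: continuous_subspaceT => x; exact: scaler_continuous.
apply: precompact_subset (_ : precompact _) => [_ [x x1 <-]|]; last first.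
  rewrite precompact_closed; first exact: C.
  apply: compact_closed => //; exact: norm_hausdorff.
by exists (T x) => //; apply: subset_closure; exists x.
Qed.

(* A is contained in a finite-dimensional subspace. *)
Definition finite_dim (A : set V) := exists (n : nat) (e : 'I_n -> V),
  forall x, A x -> exists c : 'I_n -> K, x = \sum_(i < n) c i *: e i.

End CompactOperators.

Section Projections.
Context {R : realType} {H : completeNormedModType R[i]}.
Context (dot : {dot H for (@conjC R[i])}).

Definition self_adjoint (T : H -> H) := forall x y, dot (T x) y = dot x (T y).

Definition projections : set (blinear H H) :=
  [set P : blinear H H | (forall x, P (P x) = P x) /\ self_adjoint P].

Definition projections_oo : set (blinear H H) :=
  [set P : blinear H H | [/\ projections P, ~ finite_dim (range P) &
                              ~ finite_dim (P @^-1` [set 0])]].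

Variable P0 : blinear H H.

Definition A_of : set (blinear H H) :=
  [set T : blinear H H | compact_op (fun x => T (P0 x) - P0 (T x))].

Definition C_of : set (blinear H H) :=
  [set Q : blinear H H | projections Q /\ compact_op (P0 \o Q)].

Definition A_h_pred : {pred blinear H H} :=
  fun T => `[< A_of T /\ self_adjoint T >].

Lemma A_h_predZ (r : R) T : T \in A_h_pred -> r%:C%C *: T \in A_h_pred.
Proof.
move=> /asboolP[cT sT]; apply/asboolP; split.
  rewrite /A_of /=.
  rewrite [X in compact_op X](_ : _ = r%:C%C *: (fun x => T (P0 x) - P0 (T x))).
    exact: compact_opZ.
  by apply/funext => x; rewrite [RHS]scalerBr; congr (_ - _); rewrite linearZ.
move=> x y; rewrite !blinearZE linearZl_LR linearZr_LR /= sT.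
by congr (_ * _); apply/esym; exact: conjc_real.
Qed.

Lemma A_h_zmod : zmod_closed A_h_pred.
Proof.
split.
  apply/asboolP; split.
    rewrite /A_of /=.
    rewrite [X in compact_op X](_ : _ = 0); first exact: compact_op0.
    by apply/funext => x; rewrite /= linear0 subrr.
  by move=> x y /=; rewrite linear0l linear0r.
move=> S T hS hT.
have /asboolP[cT sT] := A_h_predZ (-1) hT; have /asboolP[cS sS] := hS.
have -> : S - T = S + (-1)%:C%C *: T by rewrite rmorphN1 scaleN1r.
set T' := _ *: T in cT sT *.
apply/asboolP; split.
  rewrite /A_of /=.
  rewrite [X in compact_op X](_ : _ = (fun x => S (P0 x) - P0 (S x)) + (fun x => T' (P0 x) - P0 (T' x))).
    exact: compact_opD.
  apply/funext => x; transitivity ((S (P0 x) + T' (P0 x)) - P0 (S x + T' x)) => //.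
  by rewrite linearD opprD addrACA.
by move=> x y; rewrite !blinearDE linearDl linearDr /= sS sT.
Qed.

HB.instance Definition _ :=
  GRing.isZmodClosed.Build (blinear H H) A_h_pred A_h_zmod.

(* The real vector space of selfadjoint elements of A_of, with the operator norm
   of the complex Hilbert space H. *)
Record A_h := AhElt { A_h_op :> blinear H H; A_hP : A_h_op \in A_h_pred }.

HB.instance Definition _ := [isSub for A_h_op].
HB.instance Definition _ := [Choice of A_h by <:].
HB.instance Definition _ := [SubChoice_isSubZmodule of A_h by <:].

Definition A_h_scale (r : R) (T : A_h) : A_h := AhElt (A_h_predZ r (A_hP T)).

Fact A_h_scaleA a b T : A_h_scale a (A_h_scale b T) = A_h_scale (a * b) T.
Proof. by apply: val_inj; rewrite /= scalerA rmorphM. Qed.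

Fact A_h_scale1 : left_id 1 A_h_scale.
Proof. by move=> T; apply: val_inj; rewrite /= rmorph1 scale1r. Qed.

Fact A_h_scaleDr : right_distributive A_h_scale +%R.
Proof. by move=> a S T; apply: val_inj; rewrite /= scalerDr. Qed.

Fact A_h_scaleDl T : {morph A_h_scale^~ T : a b / a + b}.
Proof. by move=> a b; apply: val_inj; rewrite /= rmorphD scalerDl. Qed.

HB.instance Definition _ := GRing.Zmodule_isLmodule.Build R A_h
  A_h_scaleA A_h_scale1 A_h_scaleDr A_h_scaleDl.

Let nH (x : H) : R := complex.Re `|x|.
Let nrm (T : A_h) : R := op_norm nH nH T.

Let nHE (x : H) : (nH x)%:C%C = `|x|.
Proof. by rewrite /nH RRe_real// realE normr_ge0. Qed.

Let nH_ge0 x : 0 <= nH x.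
Proof. by rewrite -lecR nHE normr_ge0. Qed.

Let nrmP (T : A_h) : op_bounds nH nH T (nrm T).
Proof.
apply: op_normP => //; have [M [M0 TM]] := blinear_bound T.
have ME : (complex.Re M)%:C%C = M by rewrite RRe_real// realE M0.
exists (complex.Re M); split; first by rewrite -lecR ME.
by move=> x; rewrite -lecR rmorphM /= !nHE ME.
Qed.

Let nrmD S T : nrm (S + T) <= nrm S + nrm T.
Proof.
have [[S0 SM] [T0 TM]] := (nrmP S, nrmP T).
apply: op_norm_le; split; first exact: addr_ge0.
move=> x; rewrite mulrDl; apply: le_trans (lerD (SM x) (TM x)).
by rewrite -lecR rmorphD /= !nHE ler_normD.
Qed.

Let nrmZ_le r T : nrm (r *: T) <= `|r| * nrm T.
Proof.
have [T0 TM] := nrmP T.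
apply: op_norm_le; split; first exact: mulr_ge0.
move=> x; rewrite -mulrA.
have -> : nH ((r *: T) x) = `|r| * nH (T x).
  apply: (@complexI R); rewrite rmorphM /= !nHE.
  by rewrite normrZ normc_def /= expr0n addr0 sqrtr_sqr.
by rewrite ler_wpM2l.
Qed.

Let nrm0 T : nrm T = 0 -> T = 0.
Proof.
move=> T0; have [_] := nrmP T; rewrite T0 => TM.
apply/val_inj/val_inj/funext => x /=; apply/eqP.
by rewrite -normr_le0 -nHE -[0]/(0%:C%C) lecR; have := TM x; rewrite mul0r.
Qed.

Let nrmZ r T : nrm (r *: T) = `|r| * nrm T.
Proof.
apply/eqP; rewrite eq_le nrmZ_le /=; have [->|r0] := eqVneq r 0.
  by rewrite normr0 mul0r op_norm_ge0.
rewrite -ler_pdivlMl ?normr_gt0// -normfV -{1}[T]scale1r -(mulVf r0) -scalerA.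
exact: nrmZ_le.
Qed.

HB.instance Definition _ := Lmodule_isNormed.Build R A_h nrmD nrmZ nrm0.

Lemma A_h_normE (T : A_h) :
  `|T| = op_norm (fun x : H => complex.Re `|x|) (fun x : H => complex.Re `|x|) T.
Proof. by []. Qed.

End Projections.

(* Main.v *)
(* Near a projection Q every projection X is the orthogonal projection onto the
   graph of a bounded operator z : QH -> (1 - Q)H.  Its coordinate is the
   selfadjoint codiagonal operator w = z + z^*.  With R = (1 + w^2)^-1,
     X = 1 - Q + (2Q - 1)R + wR,   R = 1 - (X - Q)^2,   w = cod(X) R^-1,
   where cod(X) = QX + XQ - 2QXQ, so both directions only use inversion and
   products of commuting operators.  The latter are anticommutators up to a
   factor 2, hence bounded bilinear maps of the real normed space of selfadjoint
   elements of the algebra; inversion is smooth there because its derivative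
   h |-> - X^-1 h X^-1 is again a polynomial in X^-1.  Compactness of P0 X follows
   from X = Q(4r - 1) + w(w + 1)2r with r = R/2: P0 Q is compact, and
   P0 w = P0 Q w + P0 w Q is compact since w commutes with P0 modulo compacts. *)
From HB Require Import structures.
Require Import Defs.
From mathcomp Require Import all_boot all_order all_algebra.
From mathcomp Require Import complex ring lra ssrAC.
From mathcomp Require Import all_classical all_reals all_analysis.
From Stdlib Require Ncring Ncring_tac.

Set Implicit Arguments.
Unset Strict Implicit.
Unset Printing Implicit Defensive.

Import Order.TTheory GRing.Theory Num.Theory Num.Def.
Import numFieldNormedType.Exports.

Local Open Scope classical_set_scope.
Local Open Scope ring_scope.

(** * Calculus of C^k maps between real normed spaces *)

Lemma blinear_bounded_pred {K : numFieldType} (E F : normedModType K)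
    (f : E -> F) (M : K) :
  linear f -> (forall x, `|f x| <= M * `|x|) -> f \in @blinear_pred K E F.
Proof.
move=> lf fM; apply/asboolP; split=> //.
pose g : {linear E -> F} := HB.pack f (GRing.isLinear.Build _ _ _ _ f lf).
(* Nothing is assumed about the sign of [M]: a nonzero vector forces [0 <= M], and on the zero space
   [f] is constant. *)
have [x0|M0] := pselect (forall x : E, x = 0).
  suff -> : f = cst 0 by exact: cst_continuous.
  by apply/funext => x; rewrite (x0 x) [LHS](linear0 g).
have {}M0 : 0 <= M.
  apply: contra_notT M0 => M0 x; apply: contraNeq M0 => x0.
  have nx0 : 0 < `|x| by rewrite normr_gt0.
  by rewrite -(pmulr_lge0 _ nx0) (le_trans _ (fM x)).
apply: (@bounded_linear_continuous _ _ _ g); apply/linear_boundedP.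
exists M; split; first exact: ger0_real.
by move=> r /ltW Mr x; apply: le_trans (fM x) _; rewrite ler_wpM2r.
Qed.

(** * Bounded linear and bilinear maps from norm estimates *)

Section BlinearConstruction.
Context {R : realType}.
Implicit Types E F G : normedModType R.

Definition mk_blinear E F (f : E -> F) M (lf : linear f)
  (fM : forall x, `|f x| <= M * `|x|) : blinear E F :=
  BLinear (blinear_bounded_pred lf fM).

Lemma blinear_op_bounds E F (f : blinear E F) :
  op_bounds (fun x : E => `|x|) (fun x : F => `|x|) f `|f|.
Proof.
apply: op_normP; first by move=> x; exact: normr_ge0.
by have [M ?] := blinear_bound f; exists M.
Qed.

Lemma blinear_apply_le E F (f : blinear E F) x : `|f x| <= `|f| * `|x|.
Proof. by have [_] := blinear_op_bounds f. Qed.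

Lemma blinear_norm_le E F (f : blinear E F) M :
  0 <= M -> (forall x, `|f x| <= M * `|x|) -> `|f| <= M.
Proof. by move=> M0 fM; rewrite blinear_normE; apply: op_norm_le. Qed.

Lemma blinearP E F (f g : blinear E F) : (forall x, f x = g x) -> f = g.
Proof. by move=> fg; apply/val_inj/funext. Qed.

Section Bilinear.
Context {E F G : normedModType R} (B : E -> F -> G) (M : R).
Hypotheses (Bl : forall y, linear (B^~ y)) (Br : forall x, linear (B x))
  (M0 : 0 <= M) (BM : forall x y, `|B x y| <= M * `|x| * `|y|).

Let B1 x : blinear F G := mk_blinear (Br x) (BM x).

Let B1_linear : linear B1.
Proof. by move=> a x y; apply: blinearP => z; rewrite /B1 /= Bl. Qed.

Let B1_bound x : `|B1 x| <= M * `|x|.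
Proof. by apply: blinear_norm_le; [exact: mulr_ge0 | exact: BM]. Qed.

(** Curried, so that smoothness of a bilinear expression follows from [Ck_lcomp] and [Ck_app],
    without a product rule on pairs. *)
Definition mk_bilinear : blinear E (blinear F G) := mk_blinear B1_linear B1_bound.

End Bilinear.

Section Composition.
Context {E F G : normedModType R}.

Let cmp_linear (f : blinear F G) (g : blinear E F) : linear (f \o g).
Proof. by move=> a x y; rewrite /= !linearP. Qed.

Let cmp_bound (f : blinear F G) (g : blinear E F) x :
  `|(f \o g) x| <= `|f| * `|g| * `|x|.
Proof.
apply: le_trans (blinear_apply_le _ _) _; rewrite -mulrA ler_wpM2l//.
exact: blinear_apply_le.
Qed.

Definition blinear_cmp (f : blinear F G) (g : blinear E F) : blinear E G :=
  mk_blinear (cmp_linear f g) (cmp_bound f g).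

Let cmpl g : linear (blinear_cmp^~ g).
Proof. by move=> a f f'; apply: blinearP. Qed.

Let cmpr f : linear (blinear_cmp f).
Proof. by move=> a g g'; apply: blinearP => x; rewrite /= linearP. Qed.

Let cmpM f g : `|blinear_cmp f g| <= 1 * `|f| * `|g|.
Proof.
by rewrite mul1r; apply: blinear_norm_le; [exact: mulr_ge0 | exact: cmp_bound].
Qed.

Definition blinear_comp :
    blinear (blinear F G) (blinear (blinear E F) (blinear E G)) :=
  mk_bilinear cmpl cmpr ler01 cmpM.

Lemma blinear_compE f g x : blinear_comp f g x = f (g x).
Proof. by []. Qed.

End Composition.

Section Evaluation.
Context {F G : normedModType R}.

Let ev (x : F) (f : blinear F G) := f x.

Let evl f : linear (ev^~ f).
Proof. by move=> a x y; rewrite /ev linearP. Qed.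

Let evr x : linear (ev x).
Proof. by []. Qed.

Let evM x f : `|ev x f| <= 1 * `|x| * `|f|.
Proof. by rewrite mul1r mulrC; exact: blinear_apply_le. Qed.

Definition blinear_eval : blinear F (blinear (blinear F G) G) :=
  mk_bilinear evl evr ler01 evM.

Lemma blinear_evalE x f : blinear_eval x f = f x.
Proof. by []. Qed.

End Evaluation.

End BlinearConstruction.

(** * Differentiation rules and closure properties of C^k maps *)

Section SmoothCalculus.
Context {R : realType}.
Implicit Types E F G : normedModType R.

Lemma is_diffP E F (f : E -> F) x (L : blinear E F) :
  is_diff x f L <-> forall e, 0 < e ->
    \forall h \near 0, `|f (h + x) - f x - L h| <= e * `|h|.
Proof.
have key : f \o shift x = cst (f x) + L +o_ 0 id <-> forall e, 0 < e ->
    \forall h \near 0, `|f (h + x) - f x - L h| <= e * `|h|.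
  split.
    move/eqaddoP => fL e e0; have := fL e e0; apply: filterS => h.
    by rewrite !fctE opprD addrA.
  move=> fL; apply/eqaddoP => e e0; have := fL e e0; apply: filterS => h.
  by rewrite !fctE opprD addrA.
split.
  move=> [df dfE]; apply/key; rewrite -dfE.
  exact: diff_locally.
move/key => fL; have dE := diff_unique (@blinear_continuous _ _ _ L) fL.
split=> //; apply/diff_locallyP; split.
  by rewrite dE; exact: blinear_continuous.
by rewrite dE.
Qed.

Lemma is_diff_insubd E F (f : E -> F) x (L : blinear E F) :
  is_diff x f L -> insubd (0 : blinear E F) ('d f x : E -> F) = L.
Proof. by move=> [_ ->]; rewrite valKd. Qed.

Lemma differentiable_is_diff E F (f : E -> F) x : differentiable f x ->
  is_diff x f (insubd (0 : blinear E F) ('d f x : E -> F)).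
Proof.
move=> df; split=> //; rewrite val_insubd.
case: ifPn => // /negP[]; apply/asboolP; split; last exact: diff_continuous.
exact: linearP.
Qed.

Lemma near_translate E (x : E) (P : set E) :
  (\forall y \near x, P y) -> \forall h \near 0, P (h + x).
Proof. by rewrite (near_shift 0 x); apply: filterS => h /=; rewrite subr0. Qed.

Lemma is_diff_near_eq E F (f g : E -> F) x (L : blinear E F) :
  (\forall y \near x, f y = g y) -> is_diff x f L -> is_diff x g L.
Proof.
move=> fg /is_diffP fL; apply/is_diffP => e e0; have := fL e e0.
have {}fg0 : f x = g x := nbhs_singleton fg.
move/near_translate : fg => fg fh.
near=> h; have <- : f (h + x) = g (h + x) by near: h.
by rewrite -fg0; near: h.
Unshelve. all: by end_near. Qed.

(** Since [U] is open, the maps agree near each of its points, so their derivatives agree on [U] and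
    the induction passes to these. *)
Lemma Ck_ext k E F (U : set E) (f g : E -> F) : open U ->
  (forall x, U x -> f x = g x) -> Ck k U f -> Ck k U g.
Proof.
move=> oU; elim: k F f g => [|k IH] F f g fg /=.
  move=> cf x Ux; have := cf x Ux; rewrite /prop_for /continuous_at -fg//.
  apply: cvg_trans; apply: near_eq_cvg.
  by have := open_nbhs_nbhs (conj oU Ux); apply: filterS => y /fg ->.
have near_fg x : U x -> \forall y \near x, f y = g y.
  by move=> Ux; have := open_nbhs_nbhs (conj oU Ux); apply: filterS => y /fg.
move=> [df cf].
have dg x : U x -> is_diff x g (insubd (0 : blinear E F) ('d f x : E -> F)).
  move=> Ux; apply: is_diff_near_eq (near_fg x Ux) _.
  exact: differentiable_is_diff (df x Ux).
split=> [x /dg []//|]; apply: IH cf => x Ux.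
by rewrite (is_diff_insubd (dg x Ux)).
Qed.

(** Allows the derivative to be any formula valid on [U], in place of the [insubd] of the
    definition, from which it may differ outside [U]. *)
Lemma CkS k E F (U : set E) (f : E -> F) (f' : E -> blinear E F) : open U ->
  (forall x, U x -> is_diff x f (f' x)) -> Ck k U f' -> Ck k.+1 U f.
Proof.
move=> oU df cf; split=> [x /df []//|].
by apply: Ck_ext cf => // x Ux; rewrite (is_diff_insubd (df x Ux)).
Qed.

Lemma CkS_deriv k E F (U : set E) (f : E -> F) : Ck k.+1 U f ->
  exists2 f' : E -> blinear E F,
    (forall x, U x -> is_diff x f (f' x)) & Ck k U f'.
Proof.
move=> [df cf]; eexists; last exact: cf.
by move=> x /df/differentiable_is_diff.
Qed.

Lemma CkW k E F (U : set E) (f : E -> F) : Ck k.+1 U f -> Ck k U f.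
Proof.
elim: k F f => [|k IH] F f.
  by move=> [df _] x Ux; apply: differentiable_continuous; exact: df.
by move=> [df cf]; split=> //; exact: IH.
Qed.

Lemma Ck_subset k E F (U V : set E) (f : E -> F) :
  U `<=` V -> Ck k V f -> Ck k U f.
Proof.
move=> UV; elim: k F f => [|k IH] F f /=; first by move=> cf x /UV/cf.
by move=> [df cf]; split=> [x /UV/df//|]; exact: IH.
Qed.

Lemma Ck_cst k E F (U : set E) (c : F) : open U -> Ck k U (fun _ : E => c).
Proof.
move=> oU; elim: k F c => [|k IH] F c; first by move=> x _; exact: cvg_cst.
by apply: (CkS oU) (IH _ 0) => x _; exact: is_diff_cst.
Qed.

Lemma is_diff_blinear E F (L : blinear E F) x : is_diff x L L.
Proof.
apply/is_diffP => e e0; near=> h.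
by rewrite linearD addrK subrr normr0 mulr_ge0// ltW.
Unshelve. all: by end_near. Qed.

Lemma Ck_blinear k E F (U : set E) (L : blinear E F) : open U -> Ck k U L.
Proof.
move=> oU; case: k => [|k]; first by move=> x _; exact: blinear_continuous.
by apply: (CkS oU) (Ck_cst k L oU) => x _; exact: is_diff_blinear.
Qed.

Lemma is_diff_cmp E F G (f : E -> F) (g : F -> G) x (Lf : blinear E F)
    (Lg : blinear F G) :
  is_diff x f Lf -> is_diff (f x) g Lg -> is_diff x (g \o f) (blinear_comp Lg Lf).
Proof. by move=> df dg; exact: is_diff_comp. Qed.

Lemma is_diff_app E F G (f : E -> blinear F G) (g : E -> F) x Lf Lg :
  is_diff x f (Lf : blinear E _) -> is_diff x g (Lg : blinear E F) ->
  is_diff x (fun y => f y (g y))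
    (blinear_comp (blinear_eval (g x)) Lf + blinear_comp (f x) Lg).
Proof.
move=> df dg; have cg : {for x, continuous g}.
  by apply: differentiable_continuous; case: dg.
move/is_diffP : df => df; move/is_diffP : dg => dg; apply/is_diffP => e e0.
(* The remainder splits into three terms, each at most [d * C * |h|]; hence the 3 in [d]. The
   summand 1 of [C] and the cap [d <= 1] absorb the error [d * |h|] in the increment of [f]. *)
pose C := `|g x| + `|f x| + `|Lf| + 1.
have C1 : 1 <= C by rewrite lerDr !addr_ge0.
have C0 : 0 < C by exact: lt_le_trans C1.
pose d := minr 1 (e / (3 * C)).
have d0 : 0 < d by rewrite lt_min ltr01 divr_gt0// mulr_gt0.
have cgd : \forall h \near 0, `|g (h + x) - g x| <= d.
  apply: (@near_translate _ x [set y | `|g y - g x| <= d]).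
  by move/cvgr_distC_le : cg; apply.
near=> h.
have hf : `|f (h + x) - f x - Lf h| <= d * `|h| by near: h; exact: df.
have hg : `|g (h + x) - g x - Lg h| <= d * `|h| by near: h; exact: dg.
have hc : `|g (h + x) - g x| <= d by near: h.
(* Remainder of [f] at [g x], plus [f x] on the remainder of [g], plus the product of the two
   increments, small because [g] is continuous at [x]. *)
have -> : f (h + x) (g (h + x)) - f x (g x)
    - (blinear_comp (blinear_eval (g x)) Lf + blinear_comp (f x) Lg) h
  = (f (h + x) - f x - Lf h) (g x) + f x (g (h + x) - g x - Lg h)
    + (f (h + x) - f x) (g (h + x) - g x).
  rewrite !blinearDE !blinear_compE blinear_evalE !linearB /=.
  rewrite !opprfctE.
  move: (f (h + x) _) (f x (g x)) (f x _) (f x _) (f (h + x) (g x)) (Lf h (g x)).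
  move: (f x (g (h + x))) => b' a b dd q c p.
  rewrite opprK !opprD !addrA [RHS](ACl (7*2*3*6*(5*10)*(1*8)*(4*9)))%AC.
  by rewrite /= addNr !subrr !addr0.
have d1 : d <= 1 by rewrite ge_min lexx.
have dC : d * (3 * C) <= e by rewrite -ler_pdivlMr ?mulr_gt0// ge_min lexx orbT.
have hh : 0 <= `|h| by exact: normr_ge0.
have n1 : `|(f (h + x) - f x - Lf h) (g x)| <= d * `|h| * C.
  apply: le_trans (blinear_apply_le _ _) _; apply: ler_pM => //.
  by rewrite /C -!addrA lerDl !addr_ge0.
have n2 : `|f x (g (h + x) - g x - Lg h)| <= C * (d * `|h|).
  apply: le_trans (blinear_apply_le _ _) _; apply: ler_pM => //.
  by rewrite /C [`|g x| + _]addrC -!addrA lerDl !addr_ge0.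
have n3 : `|f (h + x) - f x| <= C * `|h|.
  rewrite -[f (h + x) - f x](subrK (Lf h)); apply: le_trans (ler_normD _ _) _.
  apply: le_trans (lerD hf (blinear_apply_le _ _)) _.
  rewrite -mulrDl ler_wpM2r// /C addrC -addrA; apply: le_trans (_ : `|Lf| + 1 <= _).
    by rewrite lerD2l.
  by rewrite lerDr addr_ge0.
have n4 : `|(f (h + x) - f x) (g (h + x) - g x)| <= C * `|h| * d.
  by apply: le_trans (blinear_apply_le _ _) _; apply: ler_pM.
apply: le_trans (ler_normD _ _) _; apply: le_trans (lerD (ler_normD _ _) n4) _.
apply: le_trans (lerD (lerD n1 n2) (lexx _)) _.
apply: le_trans (_ : d * (3 * C) * `|h| <= _); last by rewrite ler_wpM2r.
by rewrite le_eqVlt; apply/orP; left; apply/eqP; ring.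
Unshelve. all: by end_near. Qed.

Lemma CkD k E F (U : set E) (f g : E -> F) : open U ->
  Ck k U f -> Ck k U g -> Ck k U (fun x => f x + g x).
Proof.
move=> oU; elim: k F f g => [|k IH] F f g.
  by move=> cf cg x Ux; apply: (@continuousD _ _ _ f g); [exact: cf|exact: cg].
move=> /CkS_deriv[f' df cf] /CkS_deriv[g' dg cg].
apply: (CkS oU) (IH _ _ _ cf cg) => x Ux.
exact: (@is_diffD _ _ _ _ _ _ _ _ (df x Ux) (dg x Ux)).
Qed.

Lemma CkZ k E F (U : set E) (a : R) (f : E -> F) : open U ->
  Ck k U f -> Ck k U (fun x => a *: f x).
Proof.
move=> oU; elim: k F f => [|k IH] F f.
  by move=> cf x Ux; apply: continuousZr; exact: cf.
move=> /CkS_deriv[f' df cf].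
apply: (CkS oU) (IH _ _ cf) => x Ux.
exact: (@is_diffZ _ _ _ _ _ a _ (df x Ux)).
Qed.

Lemma CkN k E F (U : set E) (f : E -> F) : open U ->
  Ck k U f -> Ck k U (fun x => - f x).
Proof.
move=> oU cf; have -> : (fun x => - f x) = (fun x => (-1) *: f x).
  by apply/funext => x; rewrite scaleN1r.
exact: CkZ.
Qed.

Lemma Ck_lcomp k E F G (U : set E) (L : blinear F G) (f : E -> F) : open U ->
  Ck k U f -> Ck k U (fun x => L (f x)).
Proof.
move=> oU; elim: k F G L f => [|k IH] F G L f.
  move=> cf x Ux; apply: continuous_comp; first exact: cf.
  exact: blinear_continuous.
move=> /CkS_deriv[f' df cf].
apply: (CkS oU) (IH _ _ (blinear_comp L) _ cf) => x Ux.
exact: is_diff_cmp (df x Ux) (is_diff_blinear _ _).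
Qed.

(** By [is_diff_app] the derivative is a sum of two applications of the same kind between other
    spaces, so the induction runs over all [F] and [G]. It involves [f] and [g] as well as their
    derivatives, whence the use of [CkW]. *)
Lemma Ck_app k E F G (U : set E) (f : E -> blinear F G) (g : E -> F) : open U ->
  Ck k U f -> Ck k U g -> Ck k U (fun x => f x (g x)).
Proof.
move=> oU; elim: k F G f g => [|k IH] F G f g.
  move=> cf cg x Ux; have {}cf := cf x Ux; have {}cg := cg x Ux.
  have fgE : (fun y => f y (g y)) = (fun y => (f y - f x) (g y) + f x (g y)).
    by apply/funext => y; rewrite -blinearDE subrK.
  have c2 : f x (g y) @[y --> x] --> f x (g x).
    by apply: continuous_comp cg _; exact: blinear_continuous.
  have c1 : (f y - f x) (g y) @[y --> x] --> 0.
    apply/norm_cvg0P.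
    have c0 : `|f y - f x| * `|g y| @[y --> x] --> 0.
      rewrite -[X in _ --> X](mul0r `|g x|); apply: cvgM; last exact: cvg_norm.
      rewrite -(normr0 (blinear F G)) -(subrr (f x)); apply: cvg_norm.
      by apply: cvgB => //; exact: cvg_cst.
    apply: squeeze_cvgr (cvg_cst 0) c0; near=> y.
    by rewrite normr_ge0 blinear_apply_le.
  suff : f y (g y) @[y --> x] --> f x (g x) by [].
  by rewrite fgE -[f x (g x)]add0r; exact: cvgD.
move=> cf cg; have [cf0 cg0] := (CkW cf, CkW cg).
move: cf cg => /CkS_deriv[f' df cf] /CkS_deriv[g' dg cg].
apply: (CkS oU); first by move=> x Ux; exact: is_diff_app (df x Ux) (dg x Ux).
apply: CkD => //; apply: IH => //.
  by apply: Ck_lcomp => //; exact: Ck_lcomp.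
exact: Ck_lcomp.
Unshelve. all: by end_near. Qed.

(** By the chain rule the derivative is [blinear_comp] applied to [g' \o f] and [f']; the induction
    hypothesis handles [g' \o f]. *)
Lemma Ck_cmp k E F G (U : set E) (V : set F) (f : E -> F) (g : F -> G) : open U ->
  (forall x, U x -> V (f x)) -> Ck k V g -> Ck k U f -> Ck k U (g \o f).
Proof.
move=> oU UV; elim: k G g => [|k IH] G g.
  move=> cg cf x Ux; apply: continuous_comp; first exact: cf.
  by apply: cg; exact: UV.
move=> + /[dup] /CkW cf0 /CkS_deriv[f' df cf] => /CkS_deriv[g' dg cg].
apply: (CkS oU); first by move=> x Ux; exact: is_diff_cmp (df x Ux) (dg _ (UV x Ux)).
by apply: Ck_app => //; apply: Ck_lcomp => //; exact: IH.
Qed.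

End SmoothCalculus.

(** * The ring of bounded operators and its ideal of compact operators *)

Section OperatorRing.
Context {K : numFieldType} {V : normedModType K}.
Implicit Types S T : blinear V V.

Lemma blinear_id_pred : (idfun : V -> V) \in @blinear_pred K V V.
Proof. by apply/asboolP; split=> // x; exact: cvg_id. Qed.

Lemma blinear_comp_pred S T : S \o T \in @blinear_pred K V V.
Proof.
apply/asboolP; split; first by move=> a x y; rewrite /= !linearP.
by move=> x; apply: continuous_comp; exact: blinear_continuous.
Qed.

Definition op_one := BLinear blinear_id_pred.
Definition op_mul S T := BLinear (blinear_comp_pred S T).

Fact op_mulA : associative op_mul.
Proof. by move=> S T U; apply/val_inj. Qed.

Fact op_1mul : left_id op_one op_mul.
Proof. by move=> S; apply/val_inj/funext. Qed.

Fact op_mul1 : right_id op_one op_mul.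
Proof. by move=> S; apply/val_inj/funext. Qed.

Fact op_mulDl : left_distributive op_mul +%R.
Proof. by move=> S T U; apply/val_inj/funext. Qed.

Fact op_mulDr : right_distributive op_mul +%R.
Proof. by move=> S T U; apply/val_inj/funext => x; exact: linearD. Qed.

(** A ring in which [1 = 0] is possible, as [V] may be the zero space. *)
HB.instance Definition _ := GRing.Zmodule_isPzRing.Build (blinear V V)
  op_mulA op_1mul op_mul1 op_mulDl op_mulDr.

Lemma op_mulE S T x : (S * T) x = S (T x).
Proof. by []. Qed.

Lemma op_scalerAr a S T : S * (a *: T) = a *: (S * T).
Proof. by apply/val_inj/funext => x; exact: linearZ. Qed.

Lemma op_scalerAl a S T : (a *: S) * T = a *: (S * T).
Proof. by apply/val_inj/funext. Qed.

Lemma compact_op_comp S T : compact_op (S * T) -> compact_op (S \o T).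
Proof. by []. Qed.

Lemma compact_op_add S T : compact_op S -> compact_op T -> compact_op (S + T).
Proof. exact: (@compact_opD _ _ S T). Qed.

Lemma compact_opN S : compact_op S -> compact_op (- S).
Proof.
move=> cS; have -> : ((- S : blinear V V) : V -> V) = (-1) *: (S : V -> V).
  by apply/funext => x; rewrite fctE scaleN1r.
exact: compact_opZ.
Qed.

Lemma compact_op_mull S T : compact_op T -> compact_op (S * T).
Proof.
rewrite /compact_op precompactE => cT.
apply: (@precompact_subset _ _ (S @` closure (T @` [set x | `|x| <= 1]))).
  by move=> _ [x x1 <-]; exists (T x) => //; apply: subset_closure; exists x.
have C : compact (S @` closure (T @` [set x | `|x| <= 1])).
  apply: continuous_compact cT.
  by apply: continuous_subspaceT => x; exact: blinear_continuous.
rewrite precompact_closed//; apply: compact_closed C; exact: norm_hausdorff.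
Qed.

Lemma compact_op_mulr S T : compact_op S -> compact_op (S * T).
Proof.
have [M [M0 TM]] := blinear_bound T.
have M1 : 0 < M + 1 by rewrite ltr_wpDl.
move=> /(compact_opZ (M + 1)); apply: precompact_subset => _ [x /= x1 <-].
(* [T] maps the unit ball into the ball of radius [M + 1]; adding 1 keeps the scaling factor
   invertible when [M = 0]. *)
exists ((M + 1)^-1 *: T x); last first.
  by rewrite fctE linearZ scalerA divff ?gt_eqF// scale1r.
rewrite /= normrZ gtr0_norm ?invr_gt0// ler_pdivrMl// mulr1.
apply: le_trans (TM x) _; apply: le_trans (_ : M * 1 <= _).
  by rewrite ler_wpM2l.
by rewrite mulr1 lerDl.
Qed.

End OperatorRing.

(** The hypothesis says that [T] has a uniformly continuous inverse on [A]. The image of an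
    ultrafilter on [closure A] clusters, hence concentrates, at a point; the modulus makes the
    ultrafilter Cauchy, and completeness gives its limit. *)
Lemma precompact_of_modulus (K : numFieldType) (V : completeNormedModType K)
    (T : blinear V V) (A : set V) :
  (forall e, 0 < e -> exists2 d, 0 < d & forall x y, A x -> A y ->
     `|T x - T y| < d -> `|x - y| < e) ->
  precompact (T @` A) -> precompact A.
Proof.
move=> modA; rewrite !precompactE => cTA.
(* The modulus passes to the closure: both points are approximated in [A], at a cost of a quarter of
   [e] and of [d] each. *)
have modC e : 0 < e -> exists2 d, 0 < d & forall x y,
    closure A x -> closure A y -> `|T x - T y| < d -> `|x - y| < e.
  move=> e0; have e4 : 0 < e / 4 by rewrite divr_gt0.
  have [d d0 modd] := modA (e / 2) (divr_gt0 e0 (ltr0n _ 2)).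
  exists (d / 2); first by rewrite divr_gt0.
  have d4 : 0 < d / 4 by rewrite divr_gt0.
  have near_A x : closure A x ->
      exists2 y, A y & `|x - y| < e / 4 /\ `|T x - T y| < d / 4.
    move=> Ax; have Tx := @blinear_continuous _ _ _ T x _ (nbhsx_ballx (T x) _ d4).
    have [y [Ay []]] := Ax _ (filterI (nbhsx_ballx x _ e4) Tx).
    by rewrite /= -!ball_normE => ? ?; exists y.
  move=> x y /near_A[x' Ax' [xx' Txx']] /near_A[y' Ay' [yy' Tyy']] Txy.
  have Txy' : `|T x' - T y'| < d.
    apply: le_lt_trans (ler_distD (T x) _ _) _; rewrite (distrC (T x') (T x)).
    apply: le_lt_trans (lerD (lexx _) (ler_distD (T y) _ _)) _.
    have -> : d = d / 4 + (d / 2 + d / 4) by field.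
    by rewrite !ltrD.
  apply: le_lt_trans (ler_distD x' _ _) _.
  apply: le_lt_trans (lerD (lexx _) (ler_distD y' _ _)) _; rewrite (distrC y' y).
  have -> : e = e / 4 + (e / 2 + e / 4) by field.
  by rewrite !ltrD// modd.
rewrite compact_ultra => F UF FA.
have FF : ProperFilter F by exact: ultra_proper.
have TclA : closure A `<=` T @^-1` closure (T @` A).
  move=> x Ax B Bx; have [y [Ay By]] := Ax _ (@blinear_continuous _ _ _ T x _ Bx).
  by exists (T y); split=> //; exists y.
have TA : (T @ F) (closure (T @` A)) by exact: filterS TclA FA.
have [z [_ cz]] := cTA (T @ F) _ TA.
have cF : cauchy F.
  apply/cauchyP => e e0; have [d d0 modd] := modC e e0.
  have d2 : 0 < d / 2 by rewrite divr_gt0.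
  have Fz : F [set x | `|z - T x| < d / 2].
    (* An ultrafilter contains this set or its complement; the complement would contradict that [z]
       is a cluster point of the image. *)
    have [//|Fz] := in_ultra_setVsetC [set x | `|z - T x| < d / 2] UF.
    have [y [nzy]] := cz [set y | ~ `|z - y| < d / 2] _ Fz (nbhsx_ballx z _ d2).
    by rewrite -ball_normE.
  have [x [Ax zx]] := filter_ex (filterI FA Fz); exists x.
  apply: filterS (filterI FA Fz) => y [Ay zy]; rewrite -ball_normE /=.
  apply: modd => //; apply: le_lt_trans (ler_distD z _ _) _.
  by rewrite distrC (splitr d) ltrD.
have cvF : F --> lim F by exact: cauchy_cvg.
exists (lim F); split => //.
by apply: closed_closure => B /cvF FB; exact: filter_ex (filterI FA FB).
Qed.

(** * Cauchy-Schwarz and adjoints of compact operators *)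

Section Adjoint.
Context {R : realType} {H : completeNormedModType R[i]}.
Context (dot : {dot H for (@conjC R[i])}).
Hypothesis dot_norm : forall x : H, dot x x = `|x| ^+ 2.

Lemma dot_cauchy_schwarz x y : `|dot x y| <= `|x| * `|y|.
Proof.
have [->|y0] := eqVneq y 0; first by rewrite linear0r !normr0 mulr0.
have yy : 0 < dot y y by rewrite dnorm_gt0.
pose a := dot x y / dot y y; pose u := x - a *: y.
have uy : dot u y = 0.
  by rewrite linearBl /= linearZl_LR /= divfK ?subrr ?gt_eqF.
have xE : x = u + a *: y by rewrite subrK.
rewrite -(@ler_pXn2r _ 2)// ?nnegrE ?mulr_ge0// exprMn -!dot_norm.
have -> : dot x x = dot u u + `|a| ^+ 2 * dot y y.
  have uay : dot u (a *: y) = 0 by rewrite linearZr_LR /= uy mulr0.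
  rewrite {1 2}xE hnormDd//; congr (_ + _).
  by rewrite linearZl_LR linearZr_LR /= mulrA normCK.
have -> : `|dot x y| = `|a| * dot y y.
  by rewrite normrM normfV [`|dot y y|]gtr0_norm// divfK ?gt_eqF.
rewrite exprMn mulrDl -[X in _ <= _ + X]mulrA -[dot y y * dot y y]expr2 lerDr.
by rewrite mulr_ge0// dnorm_ge0.
Qed.

(* |T w|^2 = <S (T w), w>, and S T is compact. *)
Lemma compact_op_adjoint (S T : blinear H H) :
  (forall x y, dot (S x) y = dot x (T y)) -> compact_op S -> compact_op T.
Proof.
move=> ST /compact_op_mulr cS.
apply: (@precompact_of_modulus _ _ S); last first.
  by apply: precompact_subset (cS T) => _ [_ [x x1 <-] <-]; exists x.
(* A difference [w] of two points of the unit ball has norm at most 2, so Cauchy-Schwarz bounds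
   [|T w|^2] by [2 * |S (T w)|]. *)
move=> e e0; exists (e ^+ 2 / 2); first by rewrite divr_gt0// exprn_gt0.
move=> _ _ [x x1 <-] [y y1 <-]; rewrite -!linearB; set w := x - y.
have w2 : `|w| <= 2.
  by apply: le_trans (ler_normB _ _) _; rewrite -[2]/(1 + 1) lerD.
move=> hw; rewrite -(@ltr_pXn2r _ 2)// ?nnegrE ?(ltW e0)//.
rewrite -dot_norm -ST -[X in X < _]ger0_norm; last by rewrite ST dnorm_ge0.
apply: le_lt_trans (dot_cauchy_schwarz _ _) _.
apply: le_lt_trans (_ : `|S (T w)| * 2 < _).
  by rewrite ler_wpM2l.
by rewrite -ltr_pdivlMr.
Qed.

End Adjoint.

(** * Graph coordinates of idempotents in a ring *)

Ltac ncring := Ncring_tac.non_commutative_ring.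

Section IdempotentCoordinates.
Context {A : pzRingType}.
Implicit Types a b e i q r w x : A.

#[local] Instance pzRing_ops :
  @Ncring.Ring_ops A 0 1 +%R *%R (fun x y => x - y) -%R eq := {}.

#[local] Instance pzRing_Ring : Ncring.Ring (Ro := pzRing_ops).
Proof.
split; [exact: RelationClasses.eq_equivalence | by move=> x y -> ? ? -> |
  by move=> x y -> ? ? -> | by move=> x y -> ? ? -> | by move=> x y -> |
  exact: add0r | exact: addrC | exact: addrA | exact: mul1r | exact: mulr1 |
  exact: mulrA | exact: mulrDl | by move=> x y z; exact: mulrDr | by [] |
  exact: subrr].
Qed.

Definition acomm a b := a * b + b * a.

(* For idempotent q this is q w + w q - 2 q w q; the stated form only involves
   anticommutators, which unlike products preserve selfadjointness. *)
Definition codiag q w := acomm q w + acomm q w - acomm q (acomm q w).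

(* 1 - (x - q)^2 when q and x are idempotent. *)
Definition gap q x := 1 + acomm q x - q - x.

(* To be used with r = (1 + w^2)^-1 / 2. *)
Definition graph_proj q w r :=
  1 - q + (acomm q r + acomm q r) - (r + r) + acomm w r.

Lemma commr_inverse a b r : a * r = 1 -> r * a = 1 -> a * b = b * a -> r * b = b * r.
Proof.
move=> ar ra ab; rewrite -[LHS]mulr1 -ar mulrA -[r * b * a]mulrA -ab mulrA ra.
by rewrite mul1r.
Qed.

Lemma inverse_unique a r r' : a * r = 1 -> r' * a = 1 -> r = r'.
Proof. by move=> ar ra; rewrite -[r]mul1r -ra -mulrA ar mulr1. Qed.

(** Solved for [a * b * a], this expresses the quadratic map [b |-> a b a] by anticommutators
    alone. *)
Lemma acomm_square a b :
  acomm (acomm a a) b = acomm a (acomm a b) + acomm a (acomm a b)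
    - (a * b * a + a * b * a + a * b * a + a * b * a).
Proof. by rewrite /acomm; ncring. Qed.

(** For [a = X^-1] and [b = (X + h)^-1] the hypothesis is the resolvent identity; used twice, it
    shows that the error of the linear approximation [a - a h a] to [b] is of second order in
    [h]. *)
Lemma inverse_remainder a b h :
  a - b = a * h * b -> b - a + a * h * a = a * h * a * h * b.
Proof.
move=> ab; have -> : a * h * a * h * b = a * h * (a * h * b) by ncring.
by rewrite -ab mulrBr -ab; ncring.
Qed.

Section Idempotent.
Variable q : A.
Hypothesis qq : q * q = q.

Lemma codiagE w : codiag q w = q * w + w * q - (q * w * q + q * w * q).
Proof.
(* [ncring] proves identities in free variables only, so multiples of [q * q - q] are displayed for
   [qq] to remove. The same device, also with commutators, recurs below. *)
have -> : codiag q w = q * w + w * q - (q * w * q + q * w * q)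
    - ((q * q - q) * w + w * (q * q - q)).
  by rewrite /codiag /acomm; ncring.
by rewrite qq subrr mul0r mulr0 addr0 subr0.
Qed.

Lemma codiag_qwq w : q * codiag q w * q = 0.
Proof.
rewrite codiagE; have -> : q * (q * w + w * q - (q * w * q + q * w * q)) * q =
    (q * q - q) * w * q + q * w * (q * q - q)
    - ((q * q - q) * w * q * q + q * w * (q * q - q))
    - ((q * q - q) * w * q * q + q * w * (q * q - q)) by ncring.
by rewrite qq subrr !mulr0 !mul0r !addr0 !subr0.
Qed.

Lemma codiag_acomm w : acomm q (codiag q w) = codiag q w.
Proof.
apply/eqP; rewrite -subr_eq0 codiagE /acomm; apply/eqP.
have -> : q * (q * w + w * q - (q * w * q + q * w * q))
    + (q * w + w * q - (q * w * q + q * w * q)) * q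
    - (q * w + w * q - (q * w * q + q * w * q))
  = (q * q - q) * w + w * (q * q - q)
    - ((q * q - q) * w * q + q * w * (q * q - q)
       + ((q * q - q) * w * q + q * w * (q * q - q))) by ncring.
by rewrite qq subrr !mulr0 !mul0r !addr0 !subr0.
Qed.

(** Together with [codiag_acomm], this identifies the fixed points of [codiag q] with the solutions
    of [acomm q w = w], the form in which codiagonality is used from here on. *)
Lemma codiag_id w : acomm q w = w -> codiag q w = w.
Proof. by move=> qw; rewrite /codiag !qw addrK. Qed.

Lemma codiagK w : codiag q (codiag q w) = codiag q w.
Proof. exact/codiag_id/codiag_acomm. Qed.

Lemma codiag_qwq0 w : acomm q w = w -> q * w * q = 0.
Proof. by move=> /codiag_id <-; exact: codiag_qwq. Qed.

Section ToProjection.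
Variables w r : A.
Hypotheses (qw : acomm q w = w)
  (sr : (1 + 1 + acomm w w) * r = 1) (rs : r * (1 + 1 + acomm w w) = 1).

Let rw : r * w = w * r.
Proof. by apply: commr_inverse sr rs _; rewrite /acomm; ncring. Qed.

Let rq : r * q = q * r.
Proof.
apply: commr_inverse sr rs _; apply/eqP; rewrite -subr_eq0; apply/eqP.
(* A codiagonal [w] satisfies [w q = (1 - q) w]; applied twice, this makes [w^2] commute with
   [q]. *)
have wq : w * q = w - q * w by rewrite -{2}qw /acomm addrAC subrr add0r.
have -> : (1 + 1 + acomm w w) * q - q * (1 + 1 + acomm w w) =
    w * (w * q) - q * w * w + (w * (w * q) - q * w * w).
  by rewrite /acomm; ncring.
have -> : w * (w * q) - q * w * w = 0.
  rewrite wq.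
  have -> : w * (w - q * w) - q * w * w = w * w - (w * q) * w - q * w * w by ncring.
  by rewrite wq; ncring.
by rewrite addr0.
Qed.

Let x := graph_proj q w r.
Let rho := r + r.

Let wrho : (1 + w * w) * rho = 1.
Proof. by rewrite -[RHS]sr /rho /acomm; ncring. Qed.

Let xE : x = 1 - q + (q + q - 1 + w) * rho.
Proof. by rewrite /x /graph_proj /acomm rq rw /rho; ncring. Qed.

Let rhow : rho * (1 + w * w) = 1.
Proof. by rewrite -[RHS]rs /rho /acomm; ncring. Qed.

Let rho_q : rho * q = q * rho.
Proof. by rewrite /rho mulrDl mulrDr rq. Qed.

Let rho_w : rho * w = w * rho.
Proof. by rewrite /rho mulrDl mulrDr rw. Qed.

Let m := q + q - 1 + w.

Let rho_m : rho * m = m * rho.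
Proof.
have -> : rho * m = rho * q + rho * q - rho + rho * w by rewrite /m; ncring.
by rewrite rho_q rho_w /m; ncring.
Qed.

Let qm : acomm q m = q + q + w.
Proof.
have -> : acomm q m = (q * q + q * q + q * q + q * q) - q - q + acomm q w.
  by rewrite /m /acomm; ncring.
by rewrite qq qw; ncring.
Qed.

(** Here [x = 1 - q + m * rho] with [m = 2q - 1 + w]. As [w] anticommutes with [2q - 1],
    [m^2 = 1 + w^2] is the inverse of [rho], so [(m * rho)^2 = rho]. *)
Lemma graph_proj_idem : x * x = x.
Proof.
have mm : m * m = 1 + w * w.
  have -> : m * m = (q * q + q * q + q * q + q * q) - (q + q + q + q) + 1
      + acomm q w + acomm q w - w - w + w * w by rewrite /m /acomm; ncring.
  by rewrite qq qw; ncring.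
have -> : x * x = 1 - q - q + q * q + (m + m - acomm q m) * rho + m * m * rho * rho
    + m * (q * rho - rho * q) + m * (rho * m - m * rho) * rho.
  by rewrite xE -/m /acomm; ncring.
by rewrite rho_q rho_m !subrr qm qq mm wrho xE /m; ncring.
Qed.

Lemma gap_graph_proj : gap q x = r + r.
Proof.
have -> : gap q x = q + q - (q * q + q * q) + (acomm q m - m) * rho
    + m * (rho * q - q * rho).
  by rewrite /gap xE -/m /acomm; ncring.
by rewrite rho_q subrr qq qm /m -/rho; ncring.
Qed.

(** The codiagonal part of [x] is [w * rho]. Since [i] inverts [2 * rho] and commutes with [w] and
    [rho], the anticommutator with [i] strips off [rho]. *)
Lemma gap_graph_proj_inv :
  exists2 i, (gap q x + gap q x) * i = 1 /\ i * (gap q x + gap q x) = 1 &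
    acomm (codiag q x) i = w.
Proof.
rewrite gap_graph_proj -/rho.
have r2 : r * (1 + w * w) + r * (1 + w * w) = 1 by rewrite -[RHS]rhow /rho; ncring.
have r2' : (1 + w * w) * r + (1 + w * w) * r = 1 by rewrite -[RHS]wrho /rho; ncring.
(* This is [(1 + w^2) / 2]: the half is supplied by [r], as the ring has no division by 2. *)
pose i := (1 + w * w) * ((1 + w * w) * r).
have i1 : (rho + rho) * i = 1.
  have -> : (rho + rho) * i =
      (rho * (1 + w * w)) * ((1 + w * w) * r + (1 + w * w) * r).
    by rewrite /i; ncring.
  by rewrite rhow r2' mul1r.
have i2 : i * (rho + rho) = 1.
  have -> : i * (rho + rho) =
      (1 + w * w) * (((1 + w * w) * r + (1 + w * w) * r) * rho).
    by rewrite /i; ncring.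
  by rewrite r2' mul1r wrho.
exists i; first by [].
have iw : i * w = w * i by apply: commr_inverse i1 i2 _; rewrite mulrDl mulrDr rho_w.
have i_rho : i * rho = rho * i by apply: commr_inverse i1 i2 _; ncring.
have qwq : q * w * q = 0 by exact: codiag_qwq0.
have -> : codiag q x = w * rho.
  rewrite codiagE xE -/m.
  have -> : q * (1 - q + m * rho) + (1 - q + m * rho) * q -
      (q * (1 - q + m * rho) * q + q * (1 - q + m * rho) * q) =
    q + q - (q * q + q * q) - ((q * q - q * q * q) + (q * q - q * q * q))
    + (acomm q m - (q * m * q + q * m * q)) * rho
    + (m - q * m - q * m) * (rho * q - q * rho) by rewrite /acomm; ncring.
  rewrite rho_q subrr qm.
  have -> : q * m * q = q * q * q + q * q * q - q * q + q * w * q by rewrite /m; ncring.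
  by rewrite qwq !qq; ncring.
have -> : acomm (w * rho) i =
    w * ((rho + rho) * i) + (i * w - w * i) * rho + w * (i * rho - rho * i).
  by rewrite /acomm; ncring.
by rewrite i1 iw i_rho !subrr mulr1 mul0r mulr0 !addr0.
Qed.

(** Writing the leading 1 of [x] as [(1 + w^2) * rho] puts [q] or [w] at the left of every term, so
    [P0 x] is compact once [P0 q] and [P0 w] are. *)
Lemma graph_proj_factor :
  x = q * (r + r + (r + r) - 1) + w * ((w + 1) * (r + r)).
Proof.
have -> : x = (1 + w * w) * rho - q + (q + q - 1 + w) * rho by rewrite wrho xE.
by rewrite /rho; ncring.
Qed.

End ToProjection.

Section FromProjection.
Variables x i : A.
Let e := gap q x.
Hypotheses (xx : x * x = x) (ei : (e + e) * i = 1) (ie : i * (e + e) = 1).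
Let w := acomm (codiag q x) i.

Let e_q : e * q = q * e.
Proof.
have -> : e * q = q * e + (x * (q * q - q) - (q * q - q) * x).
  by rewrite /e /gap /acomm; ncring.
by rewrite qq subrr mul0r mulr0 subrr addr0.
Qed.

Let e_x : e * x = x * e.
Proof.
have -> : e * x = x * e + (q * (x * x - x) - (x * x - x) * q).
  by rewrite /e /gap /acomm; ncring.
by rewrite xx subrr mul0r mulr0 subrr addr0.
Qed.

Let iq : i * q = q * i.
Proof. by apply: commr_inverse ei ie _; rewrite mulrDl mulrDr e_q. Qed.

Let ix : i * x = x * i.
Proof. by apply: commr_inverse ei ie _; rewrite mulrDl mulrDr e_x. Qed.

Let i_e : i * e = e * i.
Proof. by apply: commr_inverse ei ie _; ncring. Qed.

Let c := codiag q x.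

Let cE : c = e - 1 + x + q - (q * e + q * e).
Proof.
have -> : q * e = q - q * q + q * x * q + (q * q - q) * x.
  by rewrite /e /gap /acomm; ncring.
by rewrite qq subrr mul0r /c codiagE /e /gap /acomm; ncring.
Qed.

Let ic : i * c = c * i.
Proof.
rewrite cE.
have -> : i * (e - 1 + x + q - (q * e + q * e)) =
    i * e - i + i * x + i * q - (i * q * e + i * q * e) by ncring.
rewrite iq ix -(mulrA q i e) i_e; ncring.
Qed.

Let j := i + i.

Let ej : e * j = 1.
Proof. by rewrite -ei /j; ncring. Qed.

Let je : j * e = 1.
Proof. by rewrite -ie /j; ncring. Qed.

Let wE : w = c * j.
Proof. by rewrite /w -/c /acomm ic /j; ncring. Qed.

Let jc : j * c = c * j.
Proof.
have -> : j * c = i * c + i * c by rewrite /j; ncring.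
by rewrite ic /j; ncring.
Qed.

Lemma codiag_chart : acomm q w = w.
Proof.
have jq : j * q = q * j by rewrite /j mulrDl mulrDr iq.
have -> : acomm q w = acomm q c * j + c * (j * q - q * j).
  by rewrite wE /acomm; ncring.
by rewrite codiag_acomm jq subrr mulr0 addr0 -wE.
Qed.

(** With [d = x - q] and [n = 2q - 1] one has [c = d + n (1 - e)], where [d^2 = 1 - e], [n^2 = 1],
    [n d + d n = 2 (e - 1)], and [e] commutes with both. *)
Let cc : c * c = e - e * e.
Proof.
pose d := x - q; pose n := q + q - 1.
have dd : d * d = 1 - e.
  have -> : d * d = 1 - e + (x * x - x) + (q * q - q).
    by rewrite /d /e /gap /acomm; ncring.
  by rewrite xx qq !subrr !addr0.
have nn : n * n = 1.
  have -> : n * n = 1 + (q * q - q) + (q * q - q) + (q * q - q) + (q * q - q).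
    by rewrite /n; ncring.
  by rewrite qq subrr !addr0.
have nd : n * d + d * n = e - 1 + (e - 1).
  have -> : n * d + d * n = e - 1 + (e - 1)
      - ((q * q - q) + (q * q - q) + (q * q - q) + (q * q - q)).
    by rewrite /n /d /e /gap /acomm; ncring.
  by rewrite qq subrr !addr0 subr0.
have cdn : c = d + n * (1 - e) by rewrite cE /d /n; ncring.
have ed : e * d = d * e.
  have -> : e * d = e * x - e * q by rewrite /d; ncring.
  by rewrite e_x e_q /d; ncring.
have en : e * n = n * e.
  have -> : e * n = e * q + e * q - e by rewrite /n; ncring.
  by rewrite e_q /n; ncring.
have -> : c * c = d * d + (n * d + d * n) * (1 - e) + n * n * (1 - e) * (1 - e)
    + n * (d * e - e * d) + n * (n * e - e * n) * (1 - e).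
  by rewrite cdn; ncring.
by rewrite ed en !subrr dd nn nd; ncring.
Qed.

(** As [w = c e^-1] and [c^2 = e - e^2], it follows that [1 + w^2 = e^-1 = j]. So [r] must be
    [e / 2], which is [e * e * i], and the graph formula reduces to [cE] solved for [x]. *)
Lemma graph_proj_chart : exists2 r,
  (1 + 1 + acomm w w) * r = 1 /\ r * (1 + 1 + acomm w w) = 1 &
  graph_proj q w r = x.
Proof.
have w2 : 1 + 1 + acomm w w = j + j.
  have -> : 1 + 1 + acomm w w = 1 + 1 + (c * c * j * j + c * c * j * j)
      + (c * (j * c - c * j) * j + c * (j * c - c * j) * j).
    by rewrite wE /acomm; ncring.
  rewrite jc subrr cc.
  have -> : (e - e * e) * j * j = (e * j) * j - e * (e * j) * j by ncring.
  by rewrite ej mulr1 ej; ncring.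
have rr : e * e * i + e * e * i = e.
  have -> : e * e * i + e * e * i = e * (e * j) by rewrite /j; ncring.
  by rewrite ej mulr1.
exists (e * e * i).
  rewrite w2; split.
    have -> : (j + j) * (e * e * i) = j * (e * e * i + e * e * i) by ncring.
    by rewrite rr.
  have -> : e * e * i * (j + j) = (e * e * i + e * e * i) * j by ncring.
  by rewrite rr.
have rq : e * e * i * q = q * (e * e * i).
  by rewrite -mulrA iq mulrA -(mulrA e) e_q !mulrA e_q.
have rw : e * e * i * w = w * (e * e * i).
  have ew : e * w = w * e.
    have ec : e * c = c * e.
      by rewrite -[LHS]mulr1 -je mulrA -(mulrA e c j) -jc !mulrA ej mul1r.
    by rewrite wE mulrA ec -mulrA ej -mulrA je.
  have iw : i * w = w * i.
    rewrite wE mulrA ic -!mulrA /j; congr (c * _); ncring.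
  by rewrite -mulrA iw mulrA -(mulrA e) ew !mulrA ew.
have -> : graph_proj q w (e * e * i) =
    1 - q + q * (e * e * i + e * e * i) + q * (e * e * i + e * e * i)
    - (e * e * i + e * e * i) + w * (e * e * i + e * e * i).
  by rewrite /graph_proj /acomm rq rw; ncring.
by rewrite rr wE -mulrA je mulr1 cE; ncring.
Qed.

End FromProjection.
End Idempotent.
End IdempotentCoordinates.

(** * Neumann series *)

Section RealOperatorNorm.
Context {R : realType} {H : completeNormedModType R[i]}.
Implicit Types (x y : H) (S T : blinear H H).

(** Norms on a module over [R[i]] take values in [R[i]]; by [rnormE] the real part loses nothing,
    and estimates can be made in [R]. *)
Definition rnorm x : R := complex.Re `|x|.

Definition op_rnorm T : R := op_norm rnorm rnorm T.

Lemma rnormE x : (rnorm x)%:C%C = `|x|.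
Proof. by rewrite /rnorm RRe_real// realE normr_ge0. Qed.

Lemma rnorm_ge0 x : 0 <= rnorm x.
Proof. by rewrite -lecR rnormE normr_ge0. Qed.

Lemma rnormD x y : rnorm (x + y) <= rnorm x + rnorm y.
Proof. by rewrite -lecR rmorphD /= !rnormE ler_normD. Qed.

Lemma rnormN x : rnorm (- x) = rnorm x.
Proof. by rewrite /rnorm normrN. Qed.

Lemma rnorm_eq0 x : rnorm x = 0 -> x = 0.
Proof. by move=> x0; apply/eqP; rewrite -normr_eq0 -rnormE x0. Qed.

Lemma op_rnormP T : op_bounds rnorm rnorm T (op_rnorm T).
Proof.
apply: op_normP; first exact: rnorm_ge0.
have [M [M0 TM]] := blinear_bound T.
have ME : (complex.Re M)%:C%C = M by rewrite RRe_real// realE M0.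
exists (complex.Re M); split; first by rewrite -lecR ME.
by move=> x; rewrite -lecR rmorphM /= !rnormE ME.
Qed.

Lemma op_rnorm_ge0 T : 0 <= op_rnorm T.
Proof. by have [] := op_rnormP T. Qed.

Lemma op_rnorm_apply T x : rnorm (T x) <= op_rnorm T * rnorm x.
Proof. by have [_] := op_rnormP T. Qed.

Lemma op_rnorm_le T M : 0 <= M -> (forall x, rnorm (T x) <= M * rnorm x) ->
  op_rnorm T <= M.
Proof. by move=> M0 TM; exact: op_norm_le. Qed.

Lemma op_rnormD S T : op_rnorm (S + T) <= op_rnorm S + op_rnorm T.
Proof.
apply: op_rnorm_le; first by rewrite addr_ge0// op_rnorm_ge0.
move=> x; apply: le_trans (rnormD _ _) _.
by rewrite mulrDl lerD// op_rnorm_apply.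
Qed.

Lemma op_rnormN T : op_rnorm (- T) = op_rnorm T.
Proof.
have le S : op_rnorm (- S) <= op_rnorm S.
  apply: op_rnorm_le; first exact: op_rnorm_ge0.
  by move=> x; rewrite [X in rnorm X <= _](_ : _ = - S x)// rnormN op_rnorm_apply.
by apply/eqP; rewrite eq_le le /= -{1}[T]opprK le.
Qed.

Lemma op_rnormM S T : op_rnorm (S * T) <= op_rnorm S * op_rnorm T.
Proof.
apply: op_rnorm_le; first by rewrite mulr_ge0// op_rnorm_ge0.
move=> x; apply: le_trans (op_rnorm_apply S (T x)) _; rewrite -mulrA.
by rewrite ler_wpM2l ?op_rnorm_ge0// op_rnorm_apply.
Qed.

Lemma rnorm_cvg {I} (F : set_system I) {FF : Filter F} (u : I -> H) l :
  (forall e, 0 < e -> \forall n \near F, rnorm (l - u n) < e) -> u @ F --> l.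
Proof.
move=> ul; apply/cvgrPdist_lt => e e0.
have eE : (complex.Re e)%:C%C = e by rewrite RRe_real// realE ltW.
have := ul (complex.Re e); rewrite -ltcR eE => /(_ e0); apply: filterS => n.
by rewrite -ltcR rnormE eE.
Qed.

(** The bound [|x| <= |x - T x| + |T| |x|], solved for [|x|]. It yields the Cauchy property of the
    iteration, injectivity of [1 - T], and boundedness of the inverse. *)
Lemma neumann_bound T x : op_rnorm T < 1 ->
  rnorm x <= (1 - op_rnorm T)^-1 * rnorm (x - T x).
Proof.
move=> T1; rewrite ler_pdivlMl ?subr_gt0// mulrBl mul1r lerBlDr.
apply: le_trans (lerD (lexx _) (op_rnorm_apply T x)).
by rewrite -{1}[x](subrK (T x)) rnormD.
Qed.

(** The iterates [u n] of [x |-> y + T x] from 0 are the partial sums of the Neumann series; they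
    solve the equation up to [v n = T^n y], which tends to 0. *)
Lemma neumann_surjective T y : op_rnorm T < 1 -> exists x, x - T x = y.
Proof.
set c := op_rnorm T => c1; have c0 : 0 <= c by exact: op_rnorm_ge0.
have c1' : 0 < 1 - c by rewrite subr_gt0.
have below x : rnorm x <= (1 - c)^-1 * rnorm (x - T x) := neumann_bound x c1.
pose u n := iter n (fun x => y + T x) 0; pose v n := iter n T y.
have uv n : u n - T (u n) = y - v n.
  elim: n => [|n IH]; first by rewrite /u /v /= linear0 !subrr.
  rewrite /u /v !iterS -/(u n) -/(v n) linearD opprD addrACA.
  by rewrite -[T (u n) - _]linearB IH linearB subrKA.
have vc n : rnorm (v n) <= c ^+ n * rnorm y.
  elim: n => [|n IH]; first by rewrite expr0 mul1r.
  rewrite /v iterS -/(v n) exprS -mulrA; apply: le_trans (op_rnorm_apply T _) _.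
  by rewrite ler_wpM2l.
have v0 e : 0 < e -> \forall n \near \oo, rnorm (v n) < e.
  move=> e0; have cn : c ^+ n * rnorm y @[n --> \oo] --> 0.
    rewrite -[X in _ --> X](mul0r (rnorm y)); apply: cvgM; last exact: cvg_cst.
    by apply: cvg_expr; rewrite ger0_norm.
  have /cvgr_lt/(_ e e0) := cn; apply: filterS => n; exact: le_lt_trans (vc n).
have cu : cauchy (u @ \oo).
  apply/cauchy_exP => e e0.
  have eE : (complex.Re e)%:C%C = e by rewrite RRe_real// realE ltW.
  (* The factor [1 - c] cancels the constant of [neumann_bound]; the half is for the two residuals
     [v n] and [v N]. *)
  have e2 : 0 < (1 - c) * (complex.Re e / 2).
    by rewrite mulr_gt0// divr_gt0// -ltcR eE.
  have [N _ vN] := v0 _ e2; exists (u N), N => // n Nn.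
  rewrite /= -ball_normE /= -rnormE -eE ltcR; apply: le_lt_trans (below _) _.
  have -> : u N - u n - T (u N - u n) = v n - v N.
    by rewrite linearB opprD addrACA -opprD !uv opprB addrC subrKA.
  rewrite ltr_pdivrMl//; apply: le_lt_trans (rnormD _ _) _; rewrite rnormN.
  by rewrite [complex.Re e]splitr mulrDr ltrD// vN//=.
have ucv : u @ \oo --> lim (u @ \oo) by exact: cauchy_cvg.
exists (lim (u @ \oo)); set x := lim _ in ucv *.
have c2 : (u n - T (u n)) @[n --> \oo] --> x - T x.
  apply: cvgB => //; apply: continuous_cvg => //; exact: blinear_continuous.
have c3 : (u n - T (u n)) @[n --> \oo] --> y.
  apply: rnorm_cvg => e /v0; apply: filterS => n.
  by rewrite uv opprB addrCA subrr addr0.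
exact: cvg_unique c2 c3.
Qed.

Lemma neumann_inverse T : op_rnorm T < 1 ->
  exists S, (1 - T) * S = 1 /\ S * (1 - T) = 1.
Proof.
move=> T1; have c1 : 0 < 1 - op_rnorm T by rewrite subr_gt0.
have below x : rnorm x <= (1 - op_rnorm T)^-1 * rnorm (x - T x) := neumann_bound x T1.
have inj x y : x - T x = y - T y -> x = y.
  move=> xy; apply/eqP; rewrite -subr_eq0; apply/eqP/rnorm_eq0/eqP.
  rewrite eq_le rnorm_ge0 andbT; apply: le_trans (below _) _.
  have -> : x - y - T (x - y) = 0.
    by rewrite linearB opprD addrACA -opprD xy subrr.
  by rewrite /rnorm normr0 mulr0.
pose s y := projT1 (cid (neumann_surjective y T1)).
have sP y : s y - T (s y) = y by rewrite /s; case: cid.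
have s_lin : linear s.
  by move=> a x y; apply: inj; rewrite sP linearP opprD addrACA -scalerBr !sP.
have s_bound x : `|s x| <= ((1 - op_rnorm T)^-1)%:C%C * `|x|.
  by rewrite -!rnormE -rmorphM /= lecR -{2}(sP x) below.
exists (BLinear (blinear_bounded_pred s_lin s_bound)).
split; apply/val_inj/funext => x; first exact: sP.
by apply: inj; rewrite sP.
Qed.

End RealOperatorNorm.

(** * The selfadjoint part of the algebra *)

(** The linear combination that isolates the triple product in [acomm_square]. *)
Lemma quarter_difference (K : numFieldType) (V : lmodType K) (v z : V) :
  4^-1 *: (v *+ 2 - z *+ 4) + (- 2^-1) *: v = - z.
Proof.
rewrite -[v *+ 2]scaler_nat -[z *+ 4]scaler_nat scalerBr !scalerA.
rewrite mulVf ?pnatr_eq0// scale1r addrAC -scalerDl.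
by rewrite [X in X *: _](_ : _ = 0) ?scale0r ?add0r//; field.
Qed.

Section SelfadjointAlgebra.
Context {R : realType} {H : completeNormedModType R[i]}.
Context (dot : {dot H for (@conjC R[i])}) (P0 : blinear H H).
Implicit Types (S T : blinear H H) (X Y Z : A_h dot P0).

Lemma A_ofE T : A_of P0 T <-> compact_op (T * P0 - P0 * T).
Proof. by []. Qed.

Lemma A_of1 : A_of P0 1.
Proof. by apply/A_ofE; rewrite mul1r mulr1 subrr; exact: compact_op0. Qed.

Lemma A_ofD S T : A_of P0 S -> A_of P0 T -> A_of P0 (S + T).
Proof.
move=> /A_ofE cS /A_ofE cT; apply/A_ofE.
have -> : (S + T) * P0 - P0 * (S + T) = S * P0 - P0 * S + (T * P0 - P0 * T).
  by rewrite mulrDl mulrDr opprD addrACA.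
exact: compact_op_add.
Qed.

Lemma A_ofM S T : A_of P0 S -> A_of P0 T -> A_of P0 (S * T).
Proof.
move=> /A_ofE cS /A_ofE cT; apply/A_ofE.
have -> : S * T * P0 - P0 * (S * T) =
    S * (T * P0 - P0 * T) + (S * P0 - P0 * S) * T.
  by rewrite mulrBr mulrBl !mulrA subrKA.
by apply: compact_op_add; [exact: compact_op_mull | exact: compact_op_mulr].
Qed.

(** The commutator of [P0] with [S^-1] is [- S^-1 [S, P0] S^-1], and compact operators form an
    ideal. *)
Lemma A_ofV S T : S * T = 1 -> T * S = 1 -> A_of P0 S -> A_of P0 T.
Proof.
move=> ST TS /A_ofE cS; apply/A_ofE.
have -> : T * P0 - P0 * T = - (T * (S * P0 - P0 * S) * T).
  by rewrite mulrBr mulrBl mulrA TS mul1r -!mulrA ST mulr1 opprB.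
by apply: compact_opN; apply: compact_op_mulr; exact: compact_op_mull.
Qed.

Lemma self_adjoint_acomm S T : self_adjoint dot S -> self_adjoint dot T ->
  self_adjoint dot (acomm S T).
Proof.
move=> sS sT x y.
by rewrite /acomm !blinearDE linearDl linearDr /= !sS !sT !sS addrC.
Qed.

Lemma self_adjointV S T : S * T = 1 -> T * S = 1 -> self_adjoint dot S ->
  self_adjoint dot T.
Proof.
move=> ST TS sS x y; have STE z : S (T z) = z by rewrite -op_mulE ST.
by rewrite -{2}(STE x) sS STE.
Qed.

Lemma A_h_mem S : A_of P0 S -> self_adjoint dot S -> S \in A_h_pred dot P0.
Proof. by move=> ? ?; apply/asboolP. Qed.

Lemma A_h_A_of X : A_of P0 X.
Proof. by have /asboolP[] := A_hP X. Qed.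

Lemma A_h_sa X : self_adjoint dot X.
Proof. by have /asboolP[] := A_hP X. Qed.

Lemma A_h_inj X Y : A_h_op X = A_h_op Y -> X = Y.
Proof. exact: val_inj. Qed.

Lemma A_h_norm_op X : `|X| = op_rnorm (A_h_op X).
Proof. by []. Qed.

Definition A_h1 : A_h dot P0 := AhElt (A_h_mem A_of1 (fun x y => erefl)).

Definition A_h_acomm X Y : A_h dot P0 :=
  AhElt (A_h_mem
    (A_ofD (A_ofM (A_h_A_of X) (A_h_A_of Y)) (A_ofM (A_h_A_of Y) (A_h_A_of X)))
    (self_adjoint_acomm (@A_h_sa X) (@A_h_sa Y))).

Let acomml Y : linear (A_h_acomm^~ Y).
Proof.
move=> a X Z; apply: A_h_inj. 
rewrite /= /acomm mulrDl mulrDr.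
by rewrite op_scalerAl op_scalerAr scalerDr addrACA.
Qed.

Let acommr X : linear (A_h_acomm X).
Proof.
move=> a Y Z; apply: A_h_inj.
rewrite /= /acomm mulrDl mulrDr.
by rewrite op_scalerAl op_scalerAr scalerDr addrACA.
Qed.

Let acommM X Y : `|A_h_acomm X Y| <= 2 * `|X| * `|Y|.
Proof.
rewrite !A_h_norm_op /= /acomm; apply: le_trans (op_rnormD _ _) _.
apply: le_trans (lerD (op_rnormM _ _) (op_rnormM _ _)) _.
by rewrite [op_rnorm Y * _]mulrC -mulrA mulr_natl mulr2n.
Qed.

Definition jordan : blinear (A_h dot P0) (blinear (A_h dot P0) (A_h dot P0)) :=
  mk_bilinear acomml acommr (ler0n _ 2) acommM.

Definition A_h_inverse X Y :=
  A_h_op X * A_h_op Y = 1 /\ A_h_op Y * A_h_op X = 1.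

Definition A_h_unit : set (A_h dot P0) := [set X | exists Y, A_h_inverse X Y].

(** The default 0 is taken at noninvertible elements; by [near_A_h_unit] it does not occur near an
    invertible one. *)
Definition A_h_inv X : A_h dot P0 := xget 0 [set Y | A_h_inverse X Y].

Lemma A_h_invP X : A_h_unit X -> A_h_inverse X (A_h_inv X).
Proof. by move=> [Y XY]; rewrite /A_h_inv; case: xgetP => [Z _ //|/(_ Y)]. Qed.

(** An inverse among all bounded operators is automatically selfadjoint and in the algebra, so
    invertibility can be tested on [H]. *)
Lemma A_h_unit_op X T : A_h_op X * T = 1 -> T * A_h_op X = 1 -> A_h_unit X.
Proof.
move=> XT TX.
have T_A : T \in A_h_pred dot P0.
  apply: A_h_mem; first exact: A_ofV XT TX (A_h_A_of X).
  exact: self_adjointV XT TX (@A_h_sa X).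
by exists (AhElt T_A).
Qed.

(** Factor [X + h = X (1 + Y h)] and invert the second factor by a Neumann series on [H];
    [A_h_unit_op] brings the result back. *)
Lemma A_h_unit_perturb X Y h : A_h_inverse X Y -> `|Y| * `|h| < 1 ->
  A_h_unit (X + h).
Proof.
move=> [XY YX] Yh.
have small : op_rnorm (- (A_h_op Y * A_h_op h)) < 1.
  by rewrite op_rnormN; apply: le_lt_trans (op_rnormM _ _) Yh.
have [S [S1 S2]] := neumann_inverse small; rewrite opprK in S1 S2.
have XhE : A_h_op (X + h) = A_h_op X * (1 + A_h_op Y * A_h_op h).
  by rewrite mulrDr mulr1 mulrA XY mul1r.
apply: (@A_h_unit_op _ (S * A_h_op Y)); rewrite XhE.
  by rewrite mulrA -[X in X * _]mulrA S1 mulr1.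
by rewrite -!mulrA (mulrA (A_h_op Y)) YX mul1r S2.
Qed.

Lemma near_A_h_unit X : A_h_unit X -> \forall h \near 0, A_h_unit (X + h).
Proof.
move=> [Y XY]; have Y1 : 0 < `|Y| + 1 by rewrite ltr_wpDl.
have small : \forall h \near (0 : A_h dot P0), `|h| < (`|Y| + 1)^-1.
  by apply/nbhs_norm0P; exists (`|Y| + 1)^-1; rewrite /= ?invr_gt0.
apply: filterS small => h hY; apply: A_h_unit_perturb XY _.
apply: le_lt_trans (_ : (`|Y| + 1) * `|h| < _).
  by rewrite ler_wpM2r// lerDl.
by rewrite -ltr_pdivlMl// mulr1.
Qed.

Lemma A_h_unit_open : open A_h_unit.
Proof.
rewrite openE => X XU; exact: (nbhs0P _ _).2 (near_A_h_unit XU).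
Qed.

(** The map [h |-> - Y h Y], written with [jordan] so that its dependence on [Y] is built from
    bounded bilinear maps. *)
Definition A_h_inv_deriv Y : blinear (A_h dot P0) (A_h dot P0) :=
  4^-1 *: jordan (jordan Y Y) + (- 2^-1) *: blinear_comp (jordan Y) (jordan Y).

Lemma A_h_inv_derivE Y h :
  A_h_op (A_h_inv_deriv Y h) = - (A_h_op Y * A_h_op h * A_h_op Y).
Proof.
have sZ : self_adjoint dot (A_h_op Y * A_h_op h * A_h_op Y).
  by move=> x y; rewrite /= !(@A_h_sa Y, @A_h_sa h).
pose Z := AhElt (A_h_mem
  (A_ofM (A_ofM (A_h_A_of Y) (A_h_A_of h)) (A_h_A_of Y)) sZ).
suff -> : A_h_inv_deriv Y h = - Z by [].
have -> : A_h_inv_deriv Y h =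
    4^-1 *: jordan (jordan Y Y) h + (- 2^-1) *: jordan Y (jordan Y h) by [].
rewrite (_ : jordan (jordan Y Y) h =
    jordan Y (jordan Y h) *+ 2 - Z *+ 4); last first.
  apply: A_h_inj; rewrite !mulrS mulr0n addr0 !addrA addr0.
  exact: acomm_square.
exact: quarter_difference.
Qed.

Lemma is_diff_A_h_inv X : A_h_unit X ->
  is_diff X A_h_inv (A_h_inv_deriv (A_h_inv X)).
Proof.
move=> XU; apply/is_diffP => e e0; set a := A_h_inv X.
have [Xa aX] := A_h_invP XU; rewrite -/a in Xa aX.
(* The remainder is at most [|a|^2 |h|^2 |b|], and [|b| <= 2 |a|], so [M * |h|^2] bounds it; adding
   1 keeps [M] positive. *)
pose M := 2 * (`|a| + 1) ^+ 3.
have a1 : 0 < `|a| + 1 by rewrite ltr_wpDl.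
have M0 : 0 < M by rewrite mulr_gt0// exprn_gt0.
have small r : 0 < r -> \forall h \near (0 : A_h dot P0), `|h| < r.
  by move=> r0; apply/nbhs_norm0P; exists r.
(* For [h] below this radius [|a| |h| <= 1/2], so the resolvent identity gives
   [|b| <= |a| + |b| / 2]. *)
have h1 : 0 < (2 * (`|a| + 1))^-1 by rewrite invr_gt0 mulr_gt0.
have h2 : 0 < e / M by rewrite divr_gt0.
apply: filterS3 (near_A_h_unit XU) (small _ h1) (small _ h2).
move=> h XhU {}h1 {}h2; rewrite [h + X]addrC; set b := A_h_inv (X + h).
have [Xb bX] := A_h_invP XhU; rewrite -/b in Xb bX.
have ab : A_h_op a - A_h_op b = A_h_op a * A_h_op h * A_h_op b.
  apply/eqP; rewrite subr_eq addrC; apply/eqP.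
  rewrite -{1}[A_h_op a]mulr1 -Xb [A_h_op (X + h)](_ : _ = A_h_op X + A_h_op h)//.
  by rewrite mulrDl mulrDr !mulrA aX mul1r.
have b_le : `|b| <= 2 * `|a|.
  have : `|b| <= `|a| + 2^-1 * `|b|.
    rewrite [X in X <= _](_ : _ = op_rnorm (A_h_op b))//.
    rewrite -[A_h_op b](subKr (A_h_op a)) ab.
    apply: le_trans (op_rnormD _ _) _; rewrite lerD2l op_rnormN.
    apply: le_trans (op_rnormM _ _) _; rewrite ler_wpM2r ?op_rnorm_ge0//.
    apply: le_trans (op_rnormM _ _) _.
    apply: le_trans (_ : (`|a| + 1) * `|h| <= _).
      by apply: ler_wpM2r; rewrite ?op_rnorm_ge0// -[op_rnorm _]/`|a| lerDl.
    rewrite -ler_pdivlMl//; apply: le_trans (ltW h1) _.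
    by rewrite invfM mulrC.
  by lra.
have -> : `|b - a - A_h_inv_deriv a h| = op_rnorm
    (A_h_op a * A_h_op h * A_h_op a * A_h_op h * A_h_op b).
  congr op_rnorm.
  rewrite [LHS](_ : _ = A_h_op b - A_h_op a - A_h_op (A_h_inv_deriv a h))//.
  by rewrite A_h_inv_derivE opprK (inverse_remainder ab).
have op4 : op_rnorm (A_h_op a * A_h_op h * A_h_op a * A_h_op h * A_h_op b) <=
    `|a| * `|h| * `|a| * `|h| * `|b|.
  do 4![apply: le_trans (op_rnormM _ _) _; rewrite ler_wpM2r ?op_rnorm_ge0//].
apply: le_trans op4 _; rewrite [leLHS](_ : _ = `|a| * `|a| * `|b| * `|h| * `|h|).
  apply: ler_wpM2r => //; apply: le_trans (_ : M * `|h| <= _).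
    apply: ler_wpM2r => //; apply: le_trans (_ : `|a| * `|a| * (2 * `|a|) <= _).
      by rewrite ler_wpM2l// mulr_ge0.
    rewrite mulrCA /M exprS expr2 [X in _ <= 2 * X]mulrA.
    rewrite ler_wpM2l//.
    by apply: ler_pM; rewrite ?mulr_ge0 ?lerDl//; apply: ler_pM; rewrite ?lerDl.
  by rewrite -ler_pdivlMl// mulrC ltW.
rewrite -!mulrA; congr (_ * _); rewrite mulrCA; congr (_ * _).
by rewrite mulrCA [RHS]mulrC -mulrA.
Qed.

(** The derivative is quadratic in the inverse itself, so each order of differentiability gives the
    next. *)
Lemma smooth_A_h_inv : smooth A_h_unit A_h_inv.
Proof.
elim=> [|k IH].
  by move=> X /is_diff_A_h_inv[/differentiable_continuous].
apply: CkS A_h_unit_open is_diff_A_h_inv _.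
have oU := A_h_unit_open; have JI := Ck_lcomp jordan oU IH.
apply: CkD => //; apply: CkZ => //.
  by apply: Ck_lcomp => //; exact: Ck_app.
by apply: Ck_app => //; exact: Ck_lcomp.
Qed.

End SelfadjointAlgebra.

(** * Charts *)

Section FixedSpace.
Context {R : realType} {E : normedModType R} (p : blinear E E).

Definition fixed_pred : {pred E} := fun x => `[< p x = x >].

Lemma fixed_submod : submod_closed fixed_pred.
Proof.
split; first by apply/asboolP; rewrite linear0.
by move=> a x y /asboolP px /asboolP py; apply/asboolP; rewrite linearP /= px py.
Qed.

HB.instance Definition _ := GRing.isSubmodClosed.Build R E fixed_pred fixed_submod.

(** The range of [p] once [p] is idempotent. It serves as model space, with its inclusion and [p]
    itself as the required splitting. *)
Record fixed_space := FixedPoint {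
  fixed_val :> E;
  fixed_valP : fixed_val \in fixed_pred }.

HB.instance Definition _ := [isSub for fixed_val].
HB.instance Definition _ := [Choice of fixed_space by <:].
HB.instance Definition _ := [SubChoice_isSubLmodule of fixed_space by <:].

Definition fixed_norm (x : fixed_space) : R := `|fixed_val x|.

Fact fixed_normD x y : fixed_norm (x + y) <= fixed_norm x + fixed_norm y.
Proof. exact: ler_normD. Qed.

Fact fixed_normZ a x : fixed_norm (a *: x) = `|a| * fixed_norm x.
Proof. exact: normrZ. Qed.

Fact fixed_norm0 x : fixed_norm x = 0 -> x = 0.
Proof. by move=> x0; apply/val_inj/normr0_eq0. Qed.

HB.instance Definition _ :=
  Lmodule_isNormed.Build R fixed_space fixed_normD fixed_normZ fixed_norm0.

Lemma fixed_val_inj (x y : fixed_space) : fixed_val x = fixed_val y -> x = y.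
Proof. exact: val_inj. Qed.

Lemma fixedE (x : fixed_space) : p (fixed_val x) = fixed_val x.
Proof. by have /asboolP := fixed_valP x. Qed.

Let incl_linear : linear fixed_val.
Proof. by []. Qed.

Let incl_bound (x : fixed_space) : `|fixed_val x| <= 1 * `|x|.
Proof. by rewrite mul1r. Qed.

Definition fixed_incl : blinear fixed_space E := mk_blinear incl_linear incl_bound.

Hypothesis pp : forall x, p (p x) = p x.

Let proj x := FixedPoint (introT (asboolP _) (pp x) : p x \in fixed_pred).

Let proj_linear : linear proj.
Proof. by move=> a x y; apply: val_inj; rewrite /= linearP. Qed.

Let proj_bound x : `|proj x| <= `|p| * `|x|.
Proof. exact: blinear_apply_le. Qed.

Definition fixed_proj : blinear E fixed_space := mk_blinear proj_linear proj_bound.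

Lemma fixed_projK : cancel fixed_incl fixed_proj.
Proof. by move=> x; apply: val_inj; exact: fixedE. Qed.

End FixedSpace.

Lemma Ck_id {R : realType} k (E : normedModType R) (U : set E) :
  open U -> Ck k U (fun x : E => x).
Proof. exact: (Ck_blinear k op_one). Qed.

Lemma preimage_smooth_open {R : realType} (E F : normedModType R) (U : set E)
    (V : set F) (f : E -> F) :
  open U -> open V -> smooth U f -> open [set x | U x /\ V (f x)].
Proof.
move=> oU oV sf; rewrite openE => x [Ux Vfx].
have := open_nbhs_nbhs (conj oU Ux); have := open_nbhs_nbhs (conj oV Vfx).
by move=> /(sf 0 x Ux) Vf Un; exact: filterI.
Qed.

(** All charts are compatible: a transition map composes an inverse chart, smooth into [E], with a
    chart map that is smooth on an open set of [E]. *)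
Lemma smooth_manifold_of_charts {R : realType} (E : normedModType R) (S : set E) :
  (forall x, S x -> exists c : chart S, chart_dom c x) -> smooth_manifold_in S.
Proof.
move=> chartS; exists (fun _ => True); split.
  by move=> x /chartS[c cx]; exists c.
move=> c d _ _ k.
have sc := @chart_inv_smooth _ _ _ c; have oc := @chart_img_open _ _ _ c.
have od := @chart_dom_open _ _ _ d; have sd := @chart_map_smooth _ _ _ d.
apply: (Ck_cmp (V := chart_dom d)) => //.
- exact: preimage_smooth_open.
- by move=> u [].
- by apply: Ck_subset (sc k) => u [].
Qed.

(** * The graph chart around a given projection *)

Section ProjectionCharts.
Context {R : realType} {H : completeNormedModType R[i]}.
Context (dot : {dot H for (@conjC R[i])}) (P0 : blinear H H).

Local Notation Ah := (A_h dot P0).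
Local Notation J := (@jordan R H dot P0).
Let S : set Ah := [set X | C_of dot P0 (A_h_op X)].

Variable Q : Ah.
Hypothesis SQ : S Q.

Let q := A_h_op Q.

Let qq : q * q = q.
Proof. by apply/val_inj/funext => x; have [[qq _] _] := SQ; exact: qq. Qed.

Definition A_h_codiag : blinear Ah Ah := J Q + J Q - blinear_comp (J Q) (J Q).

Lemma A_h_codiagE W : A_h_op (A_h_codiag W) = codiag q (A_h_op W).
Proof. by []. Qed.

Let codiag_proj W : A_h_codiag (A_h_codiag W) = A_h_codiag W.
Proof. by apply: A_h_inj; rewrite !A_h_codiagE codiagK. Qed.

Let model := fixed_space A_h_codiag.

Let model_acomm (u : model) : acomm q (A_h_op (fixed_val u)) = A_h_op (fixed_val u).
Proof. by rewrite -(fixedE u) A_h_codiagE codiag_acomm. Qed.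

(* The factor 2 cancels the one in the anticommutator of commuting operators. *)
Let double_gap (X : Ah) : Ah :=
  A_h1 dot P0 + J Q X - Q - X + (A_h1 dot P0 + J Q X - Q - X).

(** [fixed_proj] makes the value codiagonal for every [X], so the map is defined on the ambient
    space; on projections in [dom] it changes nothing, by [to_model_chart]. *)
Let to_model (X : Ah) : model :=
  fixed_proj codiag_proj (J (A_h_codiag X) (A_h_inv (double_gap X))).

Let graph_denom (u : model) : Ah :=
  A_h1 dot P0 + A_h1 dot P0 + J (fixed_val u) (fixed_val u).

Let from_model (u : model) : Ah :=
  let r := A_h_inv (graph_denom u) in
  A_h1 dot P0 - Q + (J Q r + J Q r) - (r + r) + J (fixed_val u) r.

Let dom : set Ah := [set X | A_h_unit (double_gap X)].
(** Invertibility of [2 (1 + w^2)] is imposed here instead of being derived from positivity;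
    openness then comes from that of [A_h_unit]. *)
Let img : set model := [set u | A_h_unit (graph_denom u)].

Let from_modelE u : A_h_op (from_model u) =
  graph_proj q (A_h_op (fixed_val u)) (A_h_op (A_h_inv (graph_denom u))).
Proof. by []. Qed.

Let double_gapE X : A_h_op (double_gap X) = gap q (A_h_op X) + gap q (A_h_op X).
Proof. by []. Qed.

Let graph_denomE u : A_h_op (graph_denom u) =
  1 + 1 + acomm (A_h_op (fixed_val u)) (A_h_op (fixed_val u)).
Proof. by []. Qed.

Let img_inv u : img u -> let r := A_h_op (A_h_inv (graph_denom u)) in
  let w := A_h_op (fixed_val u) in
  (1 + 1 + acomm w w) * r = 1 /\ r * (1 + 1 + acomm w w) = 1.
Proof. by move=> /A_h_invP. Qed.

Let dom_inv X : dom X -> let i := A_h_op (A_h_inv (double_gap X)) in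
  let e := gap q (A_h_op X) in (e + e) * i = 1 /\ i * (e + e) = 1.
Proof.
move=> domX; have [ei ie] := A_h_invP domX; rewrite double_gapE in ei ie.
exact: conj ei ie.
Qed.

Let from_model_dom u : img u -> (S `&` dom) (from_model u).
Proof.
move=> /img_inv /= [sr rs]; have qw := model_acomm u; split; last first.
  have [i [i1 i2] _] := gap_graph_proj_inv qq qw sr rs.
  by apply: (@A_h_unit_op _ _ _ _ _ i); rewrite double_gapE.
have [_ cq] := SQ; pose w := A_h_op (fixed_val u).
split; first split.
- by move=> x; rewrite -op_mulE from_modelE graph_proj_idem.
- exact: A_h_sa.
(* Codiagonality gives [P0 w = P0 q w + P0 w q]; exchanging [P0] and [w] in the last term costs a
   compact commutator. *)
have cw : compact_op (P0 * w).
  have -> : P0 * w = P0 * q * w + w * (P0 * q) - (w * P0 - P0 * w) * q.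
    rewrite -{1}[w]qw mulrDr mulrBl opprB !mulrA -[RHS]addrA.
    by congr (_ + _); rewrite addrC subrK.
  apply: compact_op_add; last first.
    by apply: compact_opN; apply: compact_op_mulr; exact: A_h_A_of.
  by apply: compact_op_add; [exact: compact_op_mulr | exact: compact_op_mull].
apply: compact_op_comp; rewrite from_modelE (graph_proj_factor qw sr rs).
rewrite mulrDr (mulrA P0 q) (mulrA P0 (A_h_op _)).
by apply: compact_op_add; exact: compact_op_mulr.
Qed.

Let S_idem X : S X -> A_h_op X * A_h_op X = A_h_op X.
Proof. by move=> [[xx _] _]; apply/val_inj/funext. Qed.

Let to_modelE X : A_h_op (fixed_val (to_model X)) =
  codiag q (acomm (codiag q (A_h_op X)) (A_h_op (A_h_inv (double_gap X)))).
Proof. by []. Qed.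

Let to_model_chart X : (S `&` dom) X -> A_h_op (fixed_val (to_model X)) =
  acomm (codiag q (A_h_op X)) (A_h_op (A_h_inv (double_gap X))).
Proof.
move=> [/S_idem xx /dom_inv[ei ie]].
rewrite to_modelE; apply: codiag_id; exact: codiag_chart ei ie.
Qed.

Let graph_proj_to_model X : (S `&` dom) X -> exists2 r,
  let w := A_h_op (fixed_val (to_model X)) in
  (1 + 1 + acomm w w) * r = 1 /\ r * (1 + 1 + acomm w w) = 1 &
  graph_proj q (A_h_op (fixed_val (to_model X))) r = A_h_op X.
Proof.
move=> SX; rewrite (to_model_chart SX); case: SX => /S_idem xx /dom_inv[ei ie].
exact: graph_proj_chart.
Qed.

Let to_model_img X : (S `&` dom) X -> img (to_model X).
Proof.
move=> /graph_proj_to_model[r [sr rs] _].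
by apply: (@A_h_unit_op _ _ _ _ _ r); rewrite graph_denomE; [exact: sr | exact: rs].
Qed.

Let to_modelK X : (S `&` dom) X -> from_model (to_model X) = X.
Proof.
move=> SX; have /img_inv[sr rs] := to_model_img SX.
(* This [r] and the value of [A_h_inv] invert the same operator, hence coincide. *)
have [r [sr' rs'] rX] := graph_proj_to_model SX.
by apply: A_h_inj; rewrite from_modelE -{}rX (inverse_unique sr rs').
Qed.

Let from_modelK u : img u -> to_model (from_model u) = u.
Proof.
move=> uI; have [_ /dom_inv[ei ie]] := from_model_dom uI.
have [sr rs] := img_inv uI; have qw := model_acomm u.
have [i [i1 i2] iw] := gap_graph_proj_inv qq qw sr rs.
apply/fixed_val_inj/A_h_inj; rewrite to_modelE (inverse_unique ei i2).
by rewrite from_modelE iw; exact: codiag_id.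
Qed.

Let Ck_double_gap k (U : set Ah) : open U -> Ck k U double_gap.
Proof.
move=> oU; suff CkE : Ck k U (fun X => A_h1 dot P0 + J Q X - Q - X) by exact: CkD.
apply: CkD => //; last by apply: CkN => //; exact: Ck_id.
apply: CkD => //; last exact: Ck_cst.
by apply: CkD => //; [exact: Ck_cst | exact: Ck_blinear].
Qed.

Let Ck_graph_denom k (U : set model) : open U -> Ck k U graph_denom.
Proof.
move=> oU; apply: CkD => //; first exact: Ck_cst.
have Cv : Ck k U (fun u : model => fixed_val u).
  exact: (Ck_blinear k (fixed_incl _)).
by apply: Ck_app => //; exact: Ck_lcomp.
Qed.

Let dom_open : open dom.
Proof.
have -> : dom = [set X | setT X /\ A_h_unit (double_gap X)].
  by apply/seteqP; split=> [X|X []].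
apply: preimage_smooth_open; [exact: openT | exact: A_h_unit_open |].
by move=> k; apply: Ck_double_gap; exact: openT.
Qed.

Let img_open : open img.
Proof.
have -> : img = [set u | setT u /\ A_h_unit (graph_denom u)].
  by apply/seteqP; split=> [X|X []].
apply: preimage_smooth_open; [exact: openT | exact: A_h_unit_open |].
by move=> k; apply: Ck_graph_denom; exact: openT.
Qed.

Let to_model_smooth : smooth dom to_model.
Proof.
move=> k; have od := dom_open; apply: Ck_lcomp => //.
apply: Ck_app => //; first by apply: Ck_lcomp => //; exact: Ck_blinear.
apply: (Ck_cmp (V := @A_h_unit _ _ dot P0)) (Ck_double_gap _ od) => //.
exact: smooth_A_h_inv.
Qed.

Let from_model_smooth : smooth img from_model.
Proof.
move=> k; have oi := img_open.
have Cr : Ck k img (fun u => A_h_inv (graph_denom u)).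
  apply: (Ck_cmp (V := @A_h_unit _ _ dot P0)) (Ck_graph_denom _ oi) => //.
  exact: smooth_A_h_inv.
have Cv : Ck k img (fun u : model => fixed_val u).
  exact: (Ck_blinear k (fixed_incl _)).
have Cqr : Ck k img (fun u => J Q (A_h_inv (graph_denom u))) by exact: Ck_lcomp.
apply: CkD => //; last by apply: Ck_app => //; exact: Ck_lcomp.
apply: CkD => //; last by apply: CkN => //; exact: CkD.
by apply: CkD => //; [exact: Ck_cst | exact: CkD].
Qed.

Lemma projection_chart : exists c : chart S, chart_dom c Q.
Proof.
exists (Chart (fixed_projK codiag_proj) dom_open img_open to_model_img
  from_model_dom to_modelK from_modelK to_model_smooth from_model_smooth).
(* At the centre [Q] the doubled gap is 2, with inverse [h = 1/2]. *)
have gq : gap q q = 1 by rewrite /gap /acomm qq addrA addrK addrK.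
pose h : blinear H H := 2^-1 *: op_one.
have hh : h + h = 1.
  by rewrite -scalerDl [X in X *: _](_ : _ = 1) ?scale1r//; field.
apply: (@A_h_unit_op _ _ _ _ _ h); rewrite double_gapE gq.
  by rewrite mulrDl mul1r.
by rewrite mulrDr mulr1.
Qed.

End ProjectionCharts.

(** The first conjunct justifies treating the set as a subset of the selfadjoint part of the
    algebra: [P0 Q] and its adjoint [Q P0] are both compact, hence so is the commutator of [Q] with
    [P0]. *)
Theorem corollary8p4 (R : realType) (H : completeNormedModType R[i])
    (dot : {dot H for (@conjC R[i])})
    (dot_norm : forall x : H, dot x x = `|x| ^+ 2)
    (P0 : blinear H H) (P0_oo : projections_oo dot P0) :
  (forall Q : blinear H H, C_of dot P0 Q ->
     exists X : A_h dot P0, A_h_op X = Q) /\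
  smooth_manifold_in [set X : A_h dot P0 | C_of dot P0 (A_h_op X)].
Proof.
split; last first.
  by apply: smooth_manifold_of_charts => Q SQ; exact: projection_chart.
have [[_ saP0] _ _] := P0_oo.
move=> Q [[_ saQ] cPQ].
have cQP : compact_op (Q * P0).
  apply: (@compact_op_adjoint _ _ dot dot_norm (P0 * Q)) => // x y /=.
  by rewrite saP0 saQ.
have AQ : A_of P0 Q by apply/A_ofE; apply: compact_op_add cQP _; exact: compact_opN.
by exists (AhElt (A_h_mem AQ saQ)).
Qed.
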